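(* Let $n\ge 1$, $\beta_1,\ldots,\beta_n\in(0,1)$, $\beta=\beta_1\beta_2\cdots\beta_n$ and $\lambda>0$. Let $E_\beta^{*n}(t)=E_{\beta_1}\circ E_{\beta_2}\circ\cdots\circ E_{\beta_n}(t)$, where $\{E_{\beta_1}(t)\},\ldots,\{E_{\beta_n}(t)\}$ are independent inverse stable subordinators, and let $\{N(t,\lambda)\}_{t\ge0}$ be a Poisson process of rate $\lambda$ independent of them. Then the one-dimensional distributions of the subordinated Poisson process $\{N(E_\beta^{*n}(t),\lambda)\}_{t\ge0}$ are not infinitely divisible; that is, for every $t>0$ the distribution of $N(E_\beta^{*n}(t),\lambda)$ is not infinitely divisible.
   Context: For $0<\gamma<1$, $\{D_\gamma(t)\}_{t\ge0}$ is the $\gamma$-stable subordinator, $\mathbb{E}[e^{-sD_\gamma(t)}]=e^{-ts^\gamma}$ for $s\ge0$, and the inverse $\gamma$-stable subordinator is $E_\gamma(t)=\inf\{s>0: D_\gamma(s)>t\}$. Composition means, e.g., $E_{\beta_1}\circ E_{\beta_2}(t)=E_{\beta_1}(E_{\beta_2}(t))$. *)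

(* Defs.v *)
From HB Require Import structures.
From mathcomp Require Import all_boot all_order all_algebra.
From mathcomp Require Import all_classical all_reals all_analysis.

Set Implicit Arguments.
Unset Strict Implicit.
Unset Printing Implicit Defensive.

Import Order.TTheory GRing.Theory Num.Theory.
Import numFieldNormedType.Exports.

Local Open Scope classical_set_scope.
Local Open Scope ring_scope.

(* Throughout, a stochastic process is a family indexed by R, of which only the
   times t >= 0 are ever constrained. *)

(* Mutual independence of a finite family of classes of events: the product
   rule holds for every subfamily. *)
Definition mutual_independence d (T : measurableType d) (R : realType)
    (P : probability T R) (I : finType) (F : I -> set (set T)) : Prop :=
  forall (J : {set I}) (A : I -> set T),
    (forall i, i \in J -> F i (A i)) ->
    P (\bigcap_(i in [set i | i \in J]) A i) = (\prod_(i in J) P (A i))%E.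

Definition independent_RVs d (T : measurableType d) (R : realType)
    (P : probability T R) (I : finType) (X : I -> T -> R) : Prop :=
  mutual_independence P (fun i => preimage_set_system setT (X i) measurable).

(* The sigma-algebra generated by (X t), t >= 0. *)
Definition process_sigma d' (R : realType) (T : Type) (T' : measurableType d')
    (X : R -> T -> T') : set (set T) :=
  <<s \bigcup_(t in [set t : R | 0 <= t])
        preimage_set_system setT (X t) measurable >>.

Definition independent_increments d (T : measurableType d) (R : realType)
    (P : probability T R) (X : R -> T -> R) : Prop :=
  forall (k : nat) (t : nat -> R), 0 <= t 0%N -> nondecreasing_seq t ->
    independent_RVs P (fun (i : 'I_k) w => X (t i.+1) w - X (t i) w).

(* Equality in law is tested on measurable sets only: a measure is a total set
   function, unspecified outside the sigma-algebra. *)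
Definition stationary_increments d (T : measurableType d) (R : realType)
    (P : probability T R) (X : R -> T -> R) : Prop :=
  forall s h : R, 0 <= s -> 0 <= h -> forall A : set R, measurable A ->
    P ((fun w => X (s + h) w - X s w) @^-1` A) = P (X h @^-1` A).

(* A nondecreasing path has left limits, so such a path is cadlag. *)
Definition nondecreasing_cadlag (R : realType) (x : R -> R) : Prop :=
  (forall s t : R, 0 <= s -> s <= t -> x s <= x t) /\
  (forall t : R, 0 <= t -> x u @[u --> t^'+] --> x t).

(* A Levy process with nondecreasing paths such that
   E[exp(- s D(t))] = exp(- t s^g). *)
Definition stable_subordinator d (T : measurableType d) (R : realType)
    (P : probability T R) (g : R) (D : R -> {RV P >-> R}) : Prop :=
  [/\ {ae P, forall w, D 0 w = 0},
      independent_increments P D,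
      stationary_increments P D,
      {ae P, forall w, nondecreasing_cadlag (fun t => D t w)} &
      forall t s : R, 0 <= t -> 0 <= s ->
        ('E_P[fun w => expR (- (s * D t w))] = (expR (- (t * s `^ g)))%:E)%E].

(* First passage time inf {s > 0 : x(s) > t}.  For a stable subordinator the
   set is almost surely nonempty for every t, so the convention inf set0 = 0
   only matters on a null event. *)
Definition first_passage (R : realType) (x : R -> R) (t : R) : R :=
  inf [set s : R | 0 < s /\ t < x s].

Definition inverse_stable_subordinator d (T : measurableType d) (R : realType)
    (P : probability T R) (g : R) (E : R -> {RV P >-> R}) : Prop :=
  exists D : R -> {RV P >-> R}, stable_subordinator g D /\
    {ae P, forall w, forall t, 0 <= t ->
      E t w = first_passage (fun s => D s w) t}.

Definition poisson_process d (T : measurableType d) (R : realType)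
    (P : probability T R) (lambda : R) (N : R -> {RV P >-> nat}) : Prop :=
  [/\ {ae P, forall w, N 0 w = 0%N},
      independent_increments P (fun t w => (N t w)%:R),
      {ae P, forall w, nondecreasing_cadlag (fun t => (N t w)%:R : R)} &
      forall (s h : R) (k : nat), 0 <= s -> 0 < h ->
        P [set w | N (s + h) w = (N s w + k)%N] =
          (poisson_pmf (lambda * h) k)%:E].

(* None stands for the Poisson process, Some i for the i-th E: together the
   n + 1 processes are mutually independent. *)
Definition independent_processes d (T : measurableType d) (R : realType)
    (P : probability T R) (n : nat) (E : 'I_n -> R -> {RV P >-> R})
    (N : R -> {RV P >-> nat}) : Prop :=
  mutual_independence P (fun o : option 'I_n =>
    if o is Some i then process_sigma (fun t => E i t : T -> R)
    else process_sigma (fun t => N t : T -> nat)).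

(* E_0 (E_1 ( ... (E_(n-1) (t)))), pathwise. *)
Definition iterated_composition (R : realType) (T : Type) (n : nat)
    (E : 'I_n -> R -> T -> R) (t : R) (w : T) : R :=
  foldr (fun i s => E i s w) t (enum 'I_n).

Definition infinitely_divisible (R : realType) (mu : probability R R) : Prop :=
  forall m : nat, (0 < m)%N ->
    exists (d : measure_display) (T : measurableType d) (Q : probability T R)
           (Y : 'I_m -> {RV Q >-> R}),
      [/\ independent_RVs Q Y,
          forall i j (A : set R), measurable A ->
            distribution Q (Y i) A = distribution Q (Y j) A &
          forall A : set R, measurable A ->
            Q ((fun w => \sum_(i < m) Y i w) @^-1` A) = mu A].

(* Z has a law that is not infinitely divisible.  The path properties above
   hold almost surely, so Z is a random variable only up to a null event: its
   law is that of any random variable X equal to Z almost surely, and does not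
   depend on the choice of X. *)
Definition law_not_infinitely_divisible d (T : measurableType d)
    (R : realType) (P : probability T R) (Z : T -> R) : Prop :=
  exists X : {RV P >-> R}, {ae P, forall w, X w = Z w} /\
    ~ infinitely_divisible (distribution P X).

(* Main.v *)
Require Import Defs.
From HB Require Import structures.
From mathcomp Require Import all_boot all_order all_algebra.
From mathcomp Require Import all_classical all_reals all_analysis.
From mathcomp Require Import measurable_realfun.
From mathcomp Require Import ring lra.

(** Write [S] for the iterated inverse process at the fixed time [t], [Z] for
    [N] run at time [S], [b < 1] for the product of the [beta i], and [p] for
    [1 / b].

    The law of [S].  The event [s <= E_i v] is [D_i s <= v] up to a jump of
    [D_i] at [s], so the Laplace transform of [D_i s] says that [E_i] at an
    independent exponential time of rate [z] is exponential of rate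
    [z `^ beta i].  This property composes ([tail_exponent_comp]): [S] at an
    exponential time of rate [z] is exponential of rate [z `^ b].  At the fixed
    time [t] a Chernoff bound and an exponential tilting then give
    [log (E (exp (y * S))) ~ t * y `^ p] as [y] grows, with an explicit error
    in the upper bound ([exp_moment_le], [exp_moment_ge]).

    The contradiction.  Conditionally on [S] the variable [Z] is Poisson, so
    [G x = E (exp (x * Z))] equals [E (exp (lambda * (exp x - 1) * S))].
    Suppose that [Z] is a sum of [m] independent copies of some [Y].  Then [Y]
    takes natural values, [G x] is the [m]-th power of the exponential moment
    of [Y], and [P (Z = 0)] the [m]-th power of [P (Y = 0)].  The difference of
    these [m]-th roots is the integral of [exp (x * Y)] over [Y != 0], hence
    log-convex in [x].  Multiplying by [m] and letting [m] grow shows that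
    [r := log G - log P (Z = 0)] is itself log-convex
    ([infinitely_divisible_log_moment]).

    Take [exp x = u = 2 ^+ k] and put [a := t * lambda `^ p].  The sequence
    [r / u `^ p] is log-convex and bounded, hence nonincreasing, and it tends
    to [a]; so [a * u `^ p <= r].  The upper bound on the moments gives instead
    [r <= a * (u - 1/2) `^ p + O(log u)], which is smaller because [p > 1]
    ([logconvex_growth_absurd], [moment_growth_absurd]).

    Evaluating a process at a random time is handled throughout by right
    continuity: the value is the limit of the values at the right ends of the
    cells of finer and finer grids, and on each cell the time is constant
    ([clock_subst_independent]). *)

Set Implicit Arguments.
Unset Strict Implicit.
Unset Printing Implicit Defensive.

Import Order.TTheory GRing.Theory Num.Theory.
Import numFieldNormedType.Exports.

Local Open Scope classical_set_scope.
Local Open Scope ring_scope.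

(** * Log-convex sequences and powers *)

Section real_analysis.
Context {R : realType}.
Implicit Types (a b c q x y rho eta : R) (r w : nat -> R).

Lemma bernoulli_exprn x (n : nat) : -1 <= x -> 1 + n%:R * x <= (1 + x) ^+ n.
Proof.
move=> x1; elim: n => [|n IH]; first by rewrite mul0r addr0 expr0.
rewrite exprS; apply: le_trans (ler_wpM2l _ IH); last lra.
by rewrite -natr1; have : 0 <= n%:R :> R by []; nra.
Qed.

Lemma exprn_unbounded x B : 1 < x -> exists n, B < x ^+ n.
Proof.
move=> x1.
have [n hn] : exists n : nat, (`|B| / (x - 1)) < n%:R.
  have := archi_boundP (divr_ge0 (normr_ge0 B) _ : 0 <= `|B| / (x - 1)).
  by move=> /(_ ltac:(lra)) h; exists (Num.bound (`|B| / (x - 1))).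
exists n.
have := @bernoulli_exprn (x - 1) n ltac:(lra).
rewrite (addrC x) addrA subrr add0r.
move: hn; rewrite ltr_pdivrMr; last lra.
have := ler_norm B.
by lra.
Qed.

(** The ratios of consecutive terms are nondecreasing, so a single ratio above
    1 would force geometric growth. *)
Lemma logconvex_bounded_nonincreasing w K B :
  (forall k, (K <= k)%N -> 0 < w k) ->
  (forall k, (K <= k)%N -> w k.+1 ^+ 2 <= w k * w k.+2) ->
  (forall k, w k <= B) ->
  forall k j, (K <= k)%N -> w (k + j)%N <= w k.
Proof.
move=> w0 wc wB.
have step k : (K <= k)%N -> w k.+1 <= w k.
  move=> Kk; rewrite leNgt; apply/negP => wk.
  pose x := w k.+1 / w k.
  have wk0 := w0 _ Kk.
  have x1 : 1 < x by rewrite /x ltr_pdivlMr ?mul1r.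
  have H j : x * w (k + j)%N <= w (k + j).+1.
    elim: j => [|j IH]; first by rewrite addn0 /x divfK ?gt_eqF.
    have h0 := w0 (k + j)%N (leq_trans Kk (leq_addr _ _)).
    have h1 := w0 (k + j).+1 (leq_trans Kk (leqW (leq_addr _ _))).
    have := wc (k + j)%N (leq_trans Kk (leq_addr _ _)).
    rewrite !addnS => h.
    rewrite -(ler_pM2l h0); apply: le_trans h.
    by rewrite expr2 mulrA (mulrC _ x); apply: ler_wpM2r => //; exact: ltW.
  have G j : x ^+ j * w k <= w (k + j)%N.
    elim: j => [|j IH]; first by rewrite expr0 mul1r addn0.
    rewrite exprS -mulrA addnS; apply: le_trans (H j).
    by apply: ler_wpM2l => //; lra.
  have [n hn] := exprn_unbounded (B / w k) x1.
  move: hn; rewrite ltr_pdivrMr // => hn.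
  have := le_trans (G n) (wB (k + n)%N).
  by rewrite leNgt hn.
move=> k j Kk; elim: j => [|j IH]; first by rewrite addn0.
by rewrite addnS; apply: le_trans IH; apply: step; exact: leq_trans (leq_addr _ _).
Qed.

Lemma exprn_beats_linear a x c1 c2 : 0 < a -> 1 < x ->
  exists K, forall k, (K <= k)%N -> c1 + c2 * k%:R < a * x ^+ k.
Proof.
move=> a0 x1.
(* Bernoulli for the square root y gives a quadratic minorant of x ^+ k. *)
pose y := Num.sqrt x.
have y1 : 1 < y by rewrite -sqrtr1 ltr_sqrt ?(lt_trans ltr01).
have xy : x = y ^+ 2 by rewrite sqr_sqrtr // ltW // (lt_trans ltr01).
pose C := (`|c1| + `|c2|) / (a * (y - 1) ^+ 2).
have e0 : 0 < a * (y - 1) ^+ 2 by apply: mulr_gt0 => //; apply: exprn_gt0; lra.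
have C0 : 0 <= C by apply: divr_ge0; rewrite ?addr_ge0 // ltW.
exists (Num.bound C).+1 => k hk.
have k1 : 1 <= k%:R :> R by rewrite ler1n (leq_trans _ hk).
have hC : C < k%:R.
  by apply: (lt_le_trans (archi_boundP C0)); rewrite ler_nat ltnW.
rewrite /C ltr_pdivrMr // in hC.
have h1 := ler_norm c1; have h2 := ler_norm c2.
have hb := @bernoulli_exprn (y - 1) k ltac:(lra).
rewrite (addrC y) addrA subrr add0r in hb.
have hx : (k%:R * (y - 1)) ^+ 2 <= x ^+ k.
  rewrite xy -exprM mulnC exprM lerXn2r ?nnegrE //; first by nra.
    by apply: exprn_ge0; lra.
  by lra.
apply: (@le_lt_trans _ _ ((`|c1| + `|c2|) * k%:R)).
  have : 0 <= `|c1| by [].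
  by nra.
apply: (@lt_le_trans _ _ (a * (k%:R * (y - 1)) ^+ 2)).
  rewrite (_ : a * _ = k%:R * (a * (y - 1) ^+ 2) * k%:R); last by ring.
  by rewrite ltr_pM2r //; lra.
by rewrite ler_pM2l.
Qed.

(** Optimised over [s], the first condition says that [r] is log-convex, and
    so is [w k = r k / q ^+ k]. As [w] is bounded it is nonincreasing, and the
    second condition makes [a] a lower bound for it. The last condition puts
    [w k] below [a] by [a / 2 ^+ k.+1], up to a linear function of [k] divided
    by [q ^+ k], which is smaller since [q > 2]. *)
Lemma logconvex_growth_absurd r a q c1 c2 : 0 < a -> 2 < q ->
  (forall k s, 0 < s -> 2 * s * r k.+1 <= s ^+ 2 * r k + r k.+2) ->
  (forall rho, 0 < rho < 1 ->
     exists K, forall k, (K <= k)%N -> rho * a * q ^+ k <= r k) ->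
  (forall k, r k <= a * q ^+ k * (1 - 2^-1 ^+ k / 2) + (c1 + c2 * k%:R)) ->
  False.
Proof.
move=> a0 q2 rc rlo rup.
have q0 k : 0 < q ^+ k by apply: exprn_gt0; lra.
pose w k := r k / q ^+ k.
have rE k : r k = w k * q ^+ k by rewrite /w divfK ?gt_eqF.
have [K wlo] : exists K, forall k, (K <= k)%N -> 0 < w k.
  have [K hK] := rlo (2^-1) ltac:(lra).
  exists K => k /hK h; apply: divr_gt0 => //; apply: lt_le_trans h.
  by rewrite !mulr_gt0.
have wB k : w k <= a + `|c1| + `|c2|.
  rewrite ler_pdivrMr //; apply: le_trans (rup k) _.
  have h1 := ler_norm c1; have h2 := ler_norm c2.
  have kq : 1 + k%:R <= q ^+ k.
    have := @bernoulli_exprn (q - 1) k ltac:(lra).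
    rewrite (addrC q) addrA subrr add0r; apply: le_trans.
    have : 0 <= k%:R :> R by [].
    by nra.
  have k0 : 0 <= k%:R :> R by [].
  have e0 : 0 <= 2^-1 ^+ k / 2 :> R by apply: divr_ge0 => //; apply: exprn_ge0.
  have : a * q ^+ k * (1 - 2^-1 ^+ k / 2) <= a * q ^+ k.
    by rewrite ler_piMr ?mulr_ge0 // ?ltW //; lra.
  have : c1 <= `|c1| * q ^+ k by apply: le_trans h1 _; rewrite ler_peMr //; lra.
  have : c2 * k%:R <= `|c2| * q ^+ k.
    apply: le_trans (ler_wpM2r k0 h2) _.
    by apply: ler_wpM2l => //; lra.
  by lra.
have wc k : (K <= k)%N -> w k.+1 ^+ 2 <= w k * w k.+2.
  move=> Kk.
  have w0 := wlo _ Kk; have w1 := wlo _ (leqW Kk).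
  have qp : 0 < q by lra.
  (* the optimal s is r k.+1 / r k *)
  have := rc k (q * (w k.+1 / w k)) (mulr_gt0 qp (divr_gt0 w1 w0)).
  rewrite !rE !exprS.
  set Q := q ^+ k; have Q0 : 0 < Q by exact: q0.
  set v := w k.+1 / w k.
  have vE : w k.+1 = v * w k by rewrite /v divfK ?gt_eqF.
  rewrite vE => h.
  have h2 : q ^+ 2 * Q * (2 * v ^+ 2 * w k) <= q ^+ 2 * Q * (v ^+ 2 * w k + w k.+2).
    by rewrite expr0 in h; move: h; rewrite -subr_ge0 => h; rewrite -subr_ge0; move: h; congr (0 <= _); ring.
  rewrite ler_pM2l in h2; last by rewrite mulr_gt0 // exprn_gt0 //; lra.
  have h3 : v ^+ 2 * w k <= w k.+2 by lra.
  have := ler_wpM2l (ltW w0) h3.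
  by apply: le_trans; rewrite expr0 (_ : w k * _ = v * w k * (v * w k * 1)) //; ring.
have wni := logconvex_bounded_nonincreasing wlo wc wB.
have wa k : (K <= k)%N -> a <= w k.
  move=> Kk; rewrite leNgt; apply/negP => wka.
  have w0 := wlo _ Kk.
  pose rho := (1 + w k / a) / 2.
  have va : 0 < w k / a < 1 by rewrite divr_gt0 //= ltr_pdivrMr // mul1r.
  have [K' hK'] := rlo rho ltac:(rewrite /rho; lra).
  have := hK' (k + K')%N (leq_addl _ _).
  rewrite rE ler_pM2r // => /le_trans /(_ (wni k K' Kk)).
  have -> : w k = w k / a * a by rewrite divfK ?gt_eqF.
  by rewrite ler_pM2r // /rho; lra.
have [K2 hK2] := @exprn_beats_linear (a / 2) (q / 2) c1 c2 ltac:(lra) ltac:(lra).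
pose k := maxn K K2.
have := hK2 k (leq_maxr _ _).
have := rup k; rewrite rE.
have : a * q ^+ k <= w k * q ^+ k by rewrite ler_pM2r // wa // leq_maxl.
rewrite expr_div_n exprVn.
set X := q ^+ k; set Y := 2 ^+ k.
have -> : a * X * (1 - Y^-1 / 2) = a * X - a / 2 * (X / Y) by ring.
by lra.
Qed.

(** Young's inequality for [(1 + y) `^ b] and 1, with exponents [b^-1] and [(1
    - b)^-1]. *)
Lemma powR_bernoulli y b : -1 <= y -> 0 < b < 1 -> (1 + y) `^ b <= 1 + b * y.
Proof.
move=> y1 /andP[b0 b1].
have := @conjugate_powR R ((1 + y) `^ b) 1 b^-1 (1 - b)^-1 (powR_ge0 _ _) ler01.
have bb : b + (1 - b) = 1 by lra.
rewrite !invr_gt0 !invrK subr_gt0 bb => /(_ b0 b1 erefl).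
rewrite mulr1 -powRrM mulfV ?gt_eqF // powRr1; last lra.
by rewrite powR1 mul1r; lra.
Qed.

(** This inequality and the next one compare increments of [x `^ b] with the
    derivative at [x]; both come from Bernoulli, applied to the ratio of the
    two arguments. *)
Lemma powR_diff_below x eta b : 0 < x -> 0 < eta < 1 -> 0 < b < 1 ->
  x `^ b - (x * (1 - eta)) `^ b <= b * eta * x `^ b / (1 - eta).
Proof.
move=> x0 /andP[e0 e1] /[dup] hb /andP[b0 b1].
set x' := x * (1 - eta).
have x'0 : 0 < x' by apply: mulr_gt0 => //; lra.
have xx' : x = x' * (1 + eta / (1 - eta)).
  by rewrite /x'; field; lra.
have y0 : 0 <= eta / (1 - eta) by apply: divr_ge0; lra.
have h := @powR_bernoulli (eta / (1 - eta)) b ltac:(lra) hb.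
have : x `^ b <= x' `^ b * (1 + b * (eta / (1 - eta))).
  have h1 : 0 <= 1 + eta / (1 - eta) by lra.
  by rewrite {1}xx' powRM ?(ltW x'0) //; apply: ler_wpM2l => //; exact: powR_ge0.
have : x' `^ b <= x `^ b.
  by apply: ge0_ler_powR; rewrite ?nnegrE /x' ?ltW //; nra.
have := powR_ge0 x' b.
move=> p0 p1 p2.
have : x' `^ b * (b * (eta / (1 - eta))) <= x `^ b * (b * (eta / (1 - eta))).
  by apply: ler_wpM2r => //; rewrite mulr_ge0 // ltW.
rewrite mulrDr mulr1 in p2.
have -> : b * eta * x `^ b / (1 - eta) = x `^ b * (b * (eta / (1 - eta))) by ring.
by lra.
Qed.

Lemma powR_diff_above x eta b : 0 < x -> 0 < eta -> 0 < b < 1 ->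
  b * eta * x `^ b / (1 + eta) <= (x * (1 + eta)) `^ b - x `^ b.
Proof.
move=> x0 e0 /[dup] hb /andP[b0 b1].
set x' := x * (1 + eta).
have x'0 : 0 < x' by apply: mulr_gt0 => //; lra.
have xx' : x = x' * (1 + - (eta / (1 + eta))).
  by rewrite /x'; field; lra.
have y0 : 0 <= eta / (1 + eta) by apply: divr_ge0; lra.
have y1 : eta / (1 + eta) <= 1 by rewrite ler_pdivrMr; lra.
have h := @powR_bernoulli (- (eta / (1 + eta))) b ltac:(lra) hb.
have p2 : x `^ b <= x' `^ b * (1 + b * - (eta / (1 + eta))).
  have h1 : 0 <= 1 - eta / (1 + eta) by lra.
  by rewrite {1}xx' powRM ?(ltW x'0) //; apply: ler_wpM2l => //; exact: powR_ge0.
have p1 : x `^ b <= x' `^ b.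
  by apply: ge0_ler_powR; rewrite ?nnegrE /x' ?ltW //; nra.
have : x `^ b * (b * (eta / (1 + eta))) <= x' `^ b * (b * (eta / (1 + eta))).
  by apply: ler_wpM2r => //; rewrite mulr_ge0 // ltW.
have -> : b * eta * x `^ b / (1 + eta) = x `^ b * (b * (eta / (1 + eta))) by ring.
rewrite mulrDr mulr1 mulrN mulrN in p2.
by lra.
Qed.

End real_analysis.

(** * Right-continuous paths and grids of times *)

Section clocks.
Context {R : realType}.
Implicit Types (x y : R -> R) (u : nat -> R) (l s t e : R) (B : set R).

(** The value [l] itself is allowed in the sequence, so that such convergence
    passes through locally constant paths. *)
Definition cvg_right u l := (forall k, l <= u k) /\
  (forall v, l < v -> \forall k \near \oo, u k < v).

Lemma cvg_right_cvg u l : cvg_right u l -> u @ \oo --> l.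
Proof.
move=> [ul uv]; apply/cvgrPdist_lt => e e0.
have := uv (l + e); rewrite ltrDl => /(_ e0).
apply: filterS => k uk; rewrite ler0_norm; first by rewrite opprB ltrBlDl.
by rewrite subr_le0.
Qed.

(** The last clause is right continuity, in the form it takes for a
    nondecreasing path. *)
Definition clock x := [/\ forall t, 0 <= t -> 0 <= x t,
  forall s t, 0 <= s -> s <= t -> x s <= x t &
  forall t e, 0 <= t -> 0 < e -> exists2 v, t < v & x v < x t + e].

Lemma clock_cvg_right x u t : clock x -> 0 <= t ->
  cvg_right u t -> cvg_right (x \o u) (x t).
Proof.
move=> [_ xnd xrc] t0 [ut uv]; split=> [k|v xtv] /=; first exact: xnd.
have [v' tv' xv'] := xrc t (v - x t) t0 ltac:(by rewrite subr_gt0).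
apply: filterS (uv v' tv') => k uk.
apply: le_lt_trans (xnd _ _ (le_trans t0 (ut k)) (ltW uk)) _.
by move: xv'; rewrite addrC subrK.
Qed.

Lemma clock_id : clock id.
Proof.
split=> // t e t0 e0; exists (t + e / 2); first by rewrite ltrDl divr_gt0.
by rewrite ltrD2l ltr_pdivrMr // ltr_pMr // ltrDl.
Qed.

Lemma clock_cst0 : clock (fun=> 0).
Proof.
by split=> // t e t0 e0; exists (t + 1); rewrite ?ltrDl // add0r.
Qed.

Lemma clock_comp x y : clock x -> clock y -> clock (x \o y).
Proof.
move=> [x0 xnd xrc] [y0 ynd yrc]; split=> /=.
- by move=> t /y0 /x0.
- by move=> s t s0 st; apply: xnd; [exact: y0|exact: ynd].
- move=> t e t0 e0; have [v' v'1 v'2] := xrc (y t) e (y0 _ t0) e0.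
  have [v tv yv] := yrc t (v' - y t) t0 ltac:(by rewrite subr_gt0).
  exists v => //; apply: le_lt_trans v'2; apply: xnd.
    by rewrite y0 // (le_trans t0) // ltW.
  by move: yv; rewrite addrC subrK => /ltW.
Qed.

(** The sets with a right-continuous indicator: membership survives the
    replacement of a random time by nearby later grid times. *)
Definition right_stable B := forall u l, cvg_right u l ->
  \forall k \near \oo, B (u k) <-> B l.

Lemma right_stable_itvco (a b : R) : right_stable `[a, b[%classic.
Proof.
move=> u l [ul uv]; rewrite /= !in_itv /=.
have [la|al] := ltP l a.
  apply: filterS (uv a la) => k uk; rewrite in_itv /= leNgt uk /=.
  by split => // /andP[].
have [lb|bl] := ltP l b.
  by apply: filterS (uv b lb) => k uk; rewrite in_itv /= uk (le_trans al).
by apply: nearW => k; rewrite in_itv /= andbC ltNge (le_trans bl).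
Qed.

Lemma right_stable_itvcy (a : R) : right_stable `[a, +oo[%classic.
Proof.
move=> u l [ul uv]; rewrite /= !in_itv /= andbT.
have [la|al] := ltP l a.
  by apply: filterS (uv a la) => k uk; rewrite in_itv /= andbT leNgt uk.
by apply: nearW => k; rewrite in_itv /= andbT (le_trans al).
Qed.

Definition cell (k : nat) t : nat := Num.truncn (t * k.+1%:R).
(** Right ends rather than left ends, because the paths are continuous from
    the right. *)
Definition cell_end (k j : nat) : R := j.+1%:R / k.+1%:R.

Lemma cell_eq k j t : 0 <= t ->
  (cell k t = j) <-> `[j%:R / k.+1%:R, cell_end k j[%classic t.
Proof.
move=> t0; rewrite /= in_itv /= /cell_end ler_pdivrMr // ltr_pdivlMr //.
have := @truncn_eq R (t * k.+1%:R) j (mulr_ge0 t0 (ler0n _ _)).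
by rewrite /cell => <-; split => [->|/eqP].
Qed.

Lemma cell_end_ge0 k j : 0 <= cell_end k j.
Proof. by rewrite /cell_end divr_ge0. Qed.

Lemma cell_end_cvg_right t : 0 <= t -> cvg_right (fun k => cell_end k (cell k t)) t.
Proof.
move=> t0; split => [k|v tv].
  have /cell_eq := erefl (cell k t) => /(_ t0).
  by rewrite /= in_itv /= => /andP[_ /ltW].
have h : 0 <= (v - t)^-1 by rewrite invr_ge0 subr_ge0 ltW.
exists (Num.bound (v - t)^-1) => // k /= hk.
have /cell_eq := erefl (cell k t) => /(_ t0).
rewrite /= in_itv /= => /andP[h1 _].
rewrite /cell_end -natr1 mulrDl mul1r; apply: (@le_lt_trans _ _ (t + k.+1%:R^-1)).
  by rewrite lerD2r.
rewrite -ltrBrDl invf_plt ?posrE ?subr_gt0 //.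
apply: lt_le_trans (archi_boundP h) _.
by rewrite ler_nat (leq_trans hk).
Qed.

End clocks.

Section countable_partition.
Context d (T : measurableType d) (R : realType) (P : probability T R).

Lemma measurable_fun_natP d' (U : measurableType d') (J : U -> nat) :
  (forall j, measurable [set w | J w = j]) -> measurable_fun setT J.
Proof.
move=> mJ _ Y mY; rewrite setTI.
have -> : J @^-1` Y = \bigcup_(j in Y) [set w | J w = j].
  by apply/seteqP; split => [w Yw|w [j Yj /= ->]//]; exists (J w).
by apply: bigcup_measurable => j _.
Qed.

Lemma measurable_preimage_nat d' (U : measurableType d') (J : U -> nat) j :
  measurable_fun setT J -> measurable [set w | J w = j].
Proof.
by move=> mJ; rewrite -[X in measurable X]setTI; exact: (mJ measurableT [set j]).
Qed.

Lemma measurable_fun_countable_subst d' d'' (U : measurableType d')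
    (U' : measurableType d'') (J : U -> nat) (F : nat -> U -> U') :
  measurable_fun setT J -> (forall j, measurable_fun setT (F j)) ->
  measurable_fun setT (fun w => F (J w) w).
Proof.
move=> mJ mF _ Y mY; rewrite setTI.
have -> : (fun w => F (J w) w) @^-1` Y =
    \bigcup_j ([set w | J w = j] `&` F j @^-1` Y).
  by apply/seteqP; split => [w Yw|w [j _ [/= <-]]//]; exists (J w).
apply: bigcup_measurable => j _; apply: measurableI.
  exact: measurable_preimage_nat.
by have := mF j measurableT Y mY; rewrite setTI.
Qed.

Lemma measurable_cell k d' (U : measurableType d') (V : U -> R) :
  measurable_fun setT V -> (forall w, 0 <= V w) ->
  measurable_fun setT (fun w => cell k (V w)).
Proof.
move=> mV V0; apply: measurable_fun_natP => j.
rewrite (_ : [set w | _] = V @^-1` `[j%:R / k.+1%:R, cell_end k j[); last first.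
  by apply/seteqP; split => w /=; have /= := cell_eq k j (V0 w) => -[].
by rewrite -[X in measurable X]setTI; apply: mV.
Qed.

Local Open Scope ereal_scope.

Lemma measure_partition (A : set T) (J : T -> nat) :
  measurable A -> measurable_fun setT J ->
  P A = \sum_(0 <= j <oo) P (A `&` [set w | J w = j]).
Proof.
move=> mA mJ.
have {1}-> : A = \bigcup_j (A `&` [set w | J w = j]).
  by apply/seteqP; split => [w Aw|w [j _ []]//]; exists (J w).
rewrite measure_semi_bigcup //.
- by move=> j; apply: measurableI => //; exact: measurable_preimage_nat.
- by move=> i j _ _ [w [[_ /= <-] [_ /= <-]]].
- apply: bigcup_measurable => j _.
  by apply: measurableI => //; exact: measurable_preimage_nat.
Qed.

Lemma integral_partition (f : T -> \bar R) (J : T -> nat) :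
  measurable_fun setT f -> (forall w, 0 <= f w) -> measurable_fun setT J ->
  \int[P]_w f w = \sum_(0 <= j <oo) \int[P]_(w in [set w | J w = j]) f w.
Proof.
move=> mf f0 mJ.
have E : setT = \bigcup_j [set w | J w = j].
  by apply/seteqP; split => // w _; exists (J w).
rewrite [in LHS]E ge0_integral_bigcup //.
- by move=> j; exact: measurable_preimage_nat.
- by rewrite -E.
- by move=> i j _ _ [w [/= <- <-]].
Qed.

Lemma integral_countable_subst (g : nat -> \bar R) (J : T -> nat) :
  (forall j, 0 <= g j) -> measurable_fun setT J ->
  \int[P]_w g (J w) = \sum_(0 <= j <oo) g j * P [set w | J w = j].
Proof.
move=> g0 mJ; rewrite (integral_partition (J := J)) //.
  apply: eq_eseriesr => j _.
  rewrite (eq_integral (cst (g j))) ?integral_cst //.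
    exact: measurable_preimage_nat.
  by move=> w; rewrite inE /= => ->.
exact: (measurable_fun_countable_subst (F := fun j => cst (g j))).
Qed.

Lemma probability_cvg (B_ : nat -> set T) (B : set T) :
  (forall k, measurable (B_ k)) -> measurable B ->
  (forall w, \forall k \near \oo, B_ k w <-> B w) ->
  P (B_ k) @[k --> \oo] --> P B.
Proof.
move=> mB_ mB BB.
have E C : measurable C -> P C = \int[P]_w (\1_C w)%:E.
  by move=> mC; rewrite integral_indic // setIT.
rewrite E // (_ : (fun k => P (B_ k)) = fun k => \int[P]_w (\1_(B_ k) w)%:E).
  apply: (@dominated_cvg _ _ _ _ _ measurableT _ _ (cst 1)) => //.
  - by move=> k; apply/measurable_EFinP; exact: measurable_indic.
  - move=> w _; apply: cvg_near_cst; apply: filterS (BB w) => k [h1 h2].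
    rewrite !indicE; congr ((_ : bool)%:R%:E).
    by apply/idP/idP; rewrite !inE.
  - exact: finite_measure_integrable_cst.
  - by move=> k w _; rewrite gee0_abs ?lee_fin // indicE; case: (_ \in _).
by apply/funext => k; rewrite E.
Qed.

End countable_partition.

(** * Processes at a random time *)

Section clock_processes.
Context d (T : measurableType d) (R : realType) (P : probability T R).
Implicit Types (X Y : R -> T -> R) (V : T -> R) (A : set T) (B : set R).

Definition clock_process X :=
  (forall t, 0 <= t -> measurable_fun setT (X t)) /\ (forall w, clock (X ^~ w)).

Lemma clock_process_subst_cvg X V w : clock_process X -> 0 <= V w ->
  cvg_right (fun k => X (cell_end k (cell k (V w))) w) (X (V w) w).
Proof.
move=> [_ cX] V0.
exact: (clock_cvg_right (cX w) V0 (cell_end_cvg_right V0)).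
Qed.

Lemma measurable_cell_subst X V k : clock_process X ->
  measurable_fun setT V -> (forall w, 0 <= V w) ->
  measurable_fun setT (fun w => X (cell_end k (cell k (V w))) w).
Proof.
move=> [mX _] mV V0.
apply: (measurable_fun_countable_subst (F := fun j => X (cell_end k j))).
  exact: measurable_cell.
by move=> j; apply: mX; exact: cell_end_ge0.
Qed.

Lemma measurable_clock_subst X V : clock_process X ->
  measurable_fun setT V -> (forall w, 0 <= V w) ->
  measurable_fun setT (fun w => X (V w) w).
Proof.
move=> cX mV V0.
apply: (@measurable_fun_cvg _ _ _ _
  (fun k w => X (cell_end k (cell k (V w))) w)) => //.
  by move=> k; exact: measurable_cell_subst.
by move=> w _; exact: (cvg_right_cvg (clock_process_subst_cvg cX (V0 w))).
Qed.

Lemma clock_process_comp X Y : clock_process X -> clock_process Y ->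
  clock_process (fun t w => X (Y t w) w).
Proof.
move=> cX [mY cY]; split => [t t0|w].
  apply: measurable_clock_subst => //; first exact: mY.
  by move=> w; case: (cY w) => y0 _ _; apply: y0.
exact: (clock_comp (cX.2 w) (cY w)).
Qed.

Local Open Scope ereal_scope.

Lemma measurable_preimageT V B : measurable_fun setT V -> measurable B ->
  measurable [set w | B (V w)].
Proof. by move=> mV mB; rewrite -[X in measurable X]setTI; exact: mV. Qed.

Lemma clock_law_cvg_right X B (u : nat -> R) (t : R) : clock_process X ->
  measurable B -> right_stable B -> (0 <= t)%R -> cvg_right u t ->
  P [set w | B (X (u k) w)] @[k --> \oo] --> P [set w | B (X t w)].
Proof.
move=> [mX cX] mB rB t0 ut; apply: probability_cvg => [k||w].
- apply: measurable_preimageT => //; apply: mX.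
  by apply: le_trans t0 _; case: ut.
- by apply: measurable_preimageT => //; exact: mX.
- exact: rB (clock_cvg_right (cX w) t0 ut).
Qed.

(** On a cell of the grid the time [V] is replaced by a constant, and the
    product rule applies cell by cell. Right continuity of the paths, together
    with right stability of [B], lets the mesh tend to 0 on both sides. *)
Lemma clock_subst_independent A X V B : measurable A -> clock_process X ->
  measurable_fun setT V -> (forall w, (0 <= V w)%R) ->
  measurable B -> right_stable B ->
  (forall t k j, (0 <= t)%R ->
    P (A `&` [set w | B (X t w)] `&` [set w | cell k (V w) = j]) =
    P A * P [set w | B (X t w)] * P [set w | cell k (V w) = j]) ->
  P (A `&` [set w | B (X (V w) w)]) =
  P A * \int[P]_w P [set w' | B (X (V w) w')].
Proof.
move=> mA cX mV V0 mB rB ind.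
have mJ k : measurable_fun setT (fun w => cell k (V w)).
  exact: measurable_cell.
have mXB t : (0 <= t)%R -> measurable [set w | B (X t w)].
  by move=> t0; apply: measurable_preimageT => //; exact: cX.1.
pose h t := P [set w' | B (X t w')].
have mid k : P (A `&` [set w | B (X (cell_end k (cell k (V w))) w)]) =
    P A * \int[P]_w h (cell_end k (cell k (V w))).
  have mXk : measurable [set w | B (X (cell_end k (cell k (V w))) w)].
    apply: measurable_preimageT => //; exact: measurable_cell_subst.
  rewrite (measure_partition P (measurableI _ _ mA mXk) (mJ k)).
  rewrite (@integral_countable_subst _ _ _ P (fun j => h (cell_end k j))) //.
  rewrite -(fineK (fin_num_measure P A mA)) -nneseriesZl; last first.
    by move=> j _; exact: mule_ge0.
  apply: eq_eseriesr => j _; rewrite fineK ?fin_num_measure //.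
  rewrite muleA /h -ind ?cell_end_ge0 //; congr (P _).
  apply/seteqP; split => w /= [[Aw Bw] cE]; split => //; split => //.
    by rewrite -cE.
  by rewrite cE.
have lim1 : P (A `&` [set w | B (X (cell_end k (cell k (V w))) w)])
    @[k --> \oo] --> P (A `&` [set w | B (X (V w) w)]).
  apply: probability_cvg => [k||w].
  - apply: measurableI => //; apply: measurable_preimageT => //.
    exact: measurable_cell_subst.
  - apply: measurableI => //; apply: measurable_preimageT => //.
    exact: measurable_clock_subst.
  - apply: filterS (rB _ _ (clock_process_subst_cvg cX (V0 w))) => k hk.
    by split => -[Aw /hk].
have lim2 : P A * \int[P]_w h (cell_end k (cell k (V w))) @[k --> \oo]
    --> P A * \int[P]_w h (V w).
  apply: cvgeZl; first exact: fin_num_measure.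
  apply: (@dominated_cvg _ _ _ _ _ measurableT _ _ (cst 1)) => //.
  - move=> k; apply: (measurable_fun_countable_subst
      (F := fun j => cst (h (cell_end k j)))) => //.
  - move=> w _; exact: (clock_law_cvg_right cX mB rB (V0 w)
      (cell_end_cvg_right (V0 w))).
  - exact: finite_measure_integrable_cst.
  - move=> k w _; rewrite gee0_abs ?probability_le1 //.
    exact: mXB (cell_end_ge0 _ _).
rewrite (funext mid) in lim1.
exact: cvg_unique lim1 lim2.
Qed.

End clock_processes.

(** * Laplace transforms of tail probabilities *)

Section laplace.
Context {R : realType}.
Local Notation mu := (@lebesgue_measure R).
Local Open Scope ereal_scope.

(** The mean of [f] at an exponential time of rate [z]. The density vanishes
    at negative times; the maximum makes measurability on the half-line [0 <=
    t] enough. *)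
Definition laplace (z : R) (f : R -> \bar R) : \bar R :=
  \int[mu]_t ((exponential_pdf z t)%:E * f (Num.max 0 t)%R).

Lemma exponential_pdf_max_eq z (f g : R -> \bar R) t :
  (forall v, (0 <= v)%R -> f v = g v) ->
  (exponential_pdf z t)%:E * f (Num.max 0 t)%R =
  (exponential_pdf z t)%:E * g (Num.max 0 t)%R.
Proof. by move=> fg; rewrite fg // le_max lexx. Qed.

Lemma eq_laplace z (f g : R -> \bar R) :
  (forall v, (0 <= v)%R -> f v = g v) -> laplace z f = laplace z g.
Proof. by move=> fg; apply: eq_integral => t _; exact: exponential_pdf_max_eq. Qed.

Lemma measurable_laplace_integrand z (f : R -> \bar R) :
  measurable_fun setT (fun t : R => f (Num.max 0 t)%R) ->
  measurable_fun setT (fun t : R => (exponential_pdf z t)%:E * f (Num.max 0 t)%R).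
Proof.
move=> mf; apply: emeasurable_funM => //.
by apply/measurable_EFinP; exact: measurable_exponential_pdf.
Qed.

Lemma le_laplace z (f g : R -> \bar R) : (0 < z)%R ->
  measurable_fun setT (fun t : R => f (Num.max 0 t)%R) ->
  measurable_fun setT (fun t : R => g (Num.max 0 t)%R) ->
  (forall v, (0 <= v)%R -> 0 <= f v) ->
  (forall v, (0 <= v)%R -> f v <= g v) ->
  laplace z f <= laplace z g.
Proof.
move=> z0 mf mg f0 fg.
have m0 (t : R) : (0 <= Num.max 0 t)%R by rewrite le_max lexx.
apply: ge0_le_integral => //.
- by move=> t _; rewrite mule_ge0 ?f0 // lee_fin exponential_pdf_ge0 // ltW.
- exact: measurable_laplace_integrand.
- exact: measurable_laplace_integrand.
- move=> t _; apply: lee_wpmul2l; last exact: fg.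
  by rewrite lee_fin exponential_pdf_ge0 // ltW.
Qed.

Lemma laplace_cst1 z : (0 < z)%R -> laplace z (cst 1) = 1.
Proof.
move=> z0; rewrite -[RHS](integral_exponential_pdf z0).
by apply: eq_integral => t _; rewrite mule1.
Qed.

Lemma laplace_tail_id (z s : R) : (0 < z)%R -> (0 <= s)%R ->
  laplace z (fun t => (\1_(`[s, +oo[%classic : set R) t)%:E) = (expR (- (s * z)))%:E.
Proof.
move=> z0; rewrite le_eqVlt => /orP[/eqP<-|s0].
  rewrite mul0r oppr0 expR0 -(laplace_cst1 z0); apply: eq_laplace => v v0.
  by rewrite indicE mem_set //= in_itv /= v0.
have mpdf : measurable_fun setT (fun t : R => (exponential_pdf z t)%:E).
  by apply/measurable_EFinP; exact: measurable_exponential_pdf.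
have pdf0 t : 0 <= (exponential_pdf z t)%:E.
  by rewrite lee_fin exponential_pdf_ge0 // ltW.
have E : laplace z (fun t => (\1_(`[s, +oo[%classic : set R) t)%:E) =
    \int[mu]_(t in `[s, +oo[) (exponential_pdf z t)%:E.
  rewrite [RHS]integral_mkcond; apply: eq_integral => t _.
  rewrite patchE indicE !mem_setE !in_itv /= !andbT le_max leNgt s0 /=.
  by case: ifP => _; rewrite ?mule1 ?mule0.
have split : \int[mu]_t (exponential_pdf z t)%:E =
    \int[mu]_(t in `]-oo, 0%R[) (exponential_pdf z t)%:E +
    (\int[mu]_(t in `[0%R, s]) (exponential_pdf z t)%:E +
    \int[mu]_(t in `]s, +oo[) (exponential_pdf z t)%:E).
  have -> : setT = `]-oo, 0%R[ `|` (`[0%R, s] `|` `]s, +oo[) :> set R.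
    apply/seteqP; split => t //= _; rewrite !in_itv /= !andbT.
    by case: (ltP t 0%R) => [|?]; [left|right; case: (leP t s) => ?; [left|right]].
  rewrite ge0_integral_setU //; first rewrite ge0_integral_setU //.
  - exact: measurable_funTS.
  - apply/disj_setPLR => t /=; rewrite !in_itv /= andbT => /andP[_ ts].
    by apply/negP; rewrite -leNgt.
  - by apply: measurableU.
  - exact: measurable_funTS.
  - apply/disj_setPLR => t /=; rewrite !in_itv /= andbT => t0 [].
      by move/andP => [+ _]; rewrite leNgt t0.
    by move/(lt_trans s0); rewrite ltNge ltW.
rewrite E -integral_itv_obnd_cbnd; last first.
  exact: (measurable_funTS mpdf).
move: split; rewrite integral_exponential_pdf //.
rewrite [X in X + _](_ : _ = 0) ?add0e; last first.
  apply: integral0_eq => t /=; rewrite in_itv /= => t0.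
  by rewrite lt0_exponential_pdf.
have := @exponential_prob_itv0c R z s s0; rewrite /exponential_prob => ->.
set I := \int[mu]_(t in _) _.
have I0 : 0 <= I by apply: integral_ge0.
by case: I I0 => [i| |] // _ -[] ?; congr EFin; rewrite mulrC -mulNr; lra.
Qed.

End laplace.

Section tails.
Context d (T : measurableType d) (R : realType) (P : probability T R).
Local Notation mu := (@lebesgue_measure R).
Implicit Types (X S : R -> T -> R).
Local Open Scope ereal_scope.

Definition tail X (t s : R) := P [set w | (s <= X t w)%R].

Lemma tail_itvE X t s : tail X t s = P [set w | `[s, +oo[%classic (X t w)].
Proof.
by congr (P _); apply/seteqP; split => w /=; rewrite in_itv /= andbT.
Qed.

Lemma measurable_tail_event X t s : clock_process X -> (0 <= t)%R ->
  measurable [set w | (s <= X t w)%R].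
Proof.
move=> cX t0; rewrite (_ : [set w | _] = [set w | `[s, +oo[%classic (X t w)]).
  by apply: measurable_preimageT => //; exact: cX.1.
by apply/seteqP; split => w /=; rewrite in_itv /= andbT.
Qed.

Lemma tail_le1 X t s : clock_process X -> (0 <= t)%R -> tail X t s <= 1.
Proof. by move=> cX t0; apply: probability_le1; exact: measurable_tail_event. Qed.

Lemma tail_nondecreasing X s t t' : clock_process X -> (0 <= t)%R ->
  (t <= t')%R -> tail X t s <= tail X t' s.
Proof.
move=> cX t0 tt'; apply: le_measure.
- by rewrite inE; exact: measurable_tail_event.
- by rewrite inE; apply: measurable_tail_event => //; exact: le_trans tt'.
- by move=> w /= /le_trans; apply; have [_ + _] := cX.2 w; exact.
Qed.

Lemma measurable_fun_le_event d' (U : measurableType d') (f g : U -> R) :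
  measurable_fun setT f -> measurable_fun setT g ->
  measurable [set u | (f u <= g u)%R].
Proof.
move=> mf mg; have := measurable_fun_ler mf mg measurableT (Y := [set true]).
by rewrite setTI; apply.
Qed.

Section pair_events.
Context d1 d2 (T1 : measurableType d1) (T2 : measurableType d2).
Variables (U : T1 -> R) (V : T2 -> R).
Hypotheses (mU : measurable_fun setT U) (mV : measurable_fun setT V).

Let A := [set z : T1 * T2 | (U z.1 <= V z.2)%R].
Let f (z : T1 * T2) := (\1_A z)%:E : \bar R.

Let mf : measurable_fun setT f.
Proof.
apply/measurable_EFinP; apply: measurable_indic.
by apply: measurable_fun_le_event; apply: measurableT_comp.
Qed.

Let f0 z : 0 <= f z. Proof. by rewrite lee_fin. Qed.

Let fiber1 (Q : probability T2 R) w1 :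
  \int[Q]_w f (w1, w) = Q [set w | (U w1 <= V w)%R].
Proof.
have mUV : measurable [set w | (U w1 <= V w)%R].
  by apply: measurable_fun_le_event => //; exact: measurable_cst.
have := @integral_indic _ _ _ Q setT measurableT _ mUV; rewrite setIT => <-.
by apply: eq_integral => w _; rewrite /f !indicE !mem_setE.
Qed.

Let fiber2 (Q : probability T1 R) w2 :
  \int[Q]_w f (w, w2) = Q [set w | (U w <= V w2)%R].
Proof.
have mUV : measurable [set w | (U w <= V w2)%R].
  by apply: measurable_fun_le_event => //; exact: measurable_cst.
have := @integral_indic _ _ _ Q setT measurableT _ mUV; rewrite setIT => <-.
by apply: eq_integral => w _; rewrite /f !indicE !mem_setE.
Qed.

Lemma measurable_fun_le_probability (Q : probability T2 R) :
  measurable_fun setT (fun w1 => Q [set w | (U w1 <= V w)%R]).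
Proof.
rewrite (_ : (fun w1 => _) = fubini_F Q f).
  exact: measurable_fun_fubini_tonelli_F.
by apply/funext => w1; rewrite /fubini_F fiber1.
Qed.

Lemma measurable_fun_ge_probability (Q : probability T1 R) :
  measurable_fun setT (fun w2 => Q [set w | (U w <= V w2)%R]).
Proof.
rewrite (_ : (fun w2 => _) = fubini_G Q f).
  exact: measurable_fun_fubini_tonelli_G.
by apply/funext => w2; rewrite /fubini_G fiber2.
Qed.

(** Tonelli's theorem for the event [U <= V] under the product measure. *)
Lemma le_probability_swap (Q1 : probability T1 R) (Q2 : probability T2 R) :
  \int[Q2]_w2 Q1 [set w1 | (U w1 <= V w2)%R] =
  \int[Q1]_w1 Q2 [set w2 | (U w1 <= V w2)%R].
Proof.
have := @fubini_tonelli _ _ _ _ _ Q1 Q2 f mf f0.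
under eq_integral do rewrite fiber1.
by under [in RHS]eq_integral do rewrite fiber2.
Qed.

End pair_events.

(** Joint measurability in the time and the level: the tail is the limit of
    its values at grid times, and for a fixed time it is the probability of [c
    <= S t], measurable in [c] by Tonelli. *)
Lemma measurable_tail_comp S d' (W : measurableType d') (t c : W -> R) :
  clock_process S -> measurable_fun setT t -> (forall z, (0 <= t z)%R) ->
  measurable_fun setT c -> measurable_fun setT (fun z => tail S (t z) (c z)).
Proof.
move=> cS mt t0 mc.
refine (emeasurable_fun_cvg
  (fun k z => tail S (cell_end k (cell k (t z))) (c z)) _ _ _).
  move=> k; apply: (measurable_fun_countable_subst
      (F := fun j z => tail S (cell_end k j) (c z))) => [|j].
    exact: measurable_cell.
  apply: measurable_fun_le_probability => //.
  by apply: cS.1; exact: cell_end_ge0.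
move=> z _; rewrite tail_itvE.
under eq_fun do rewrite tail_itvE.
apply: clock_law_cvg_right => //; first exact: right_stable_itvcy.
exact: cell_end_cvg_right.
Qed.

Lemma measurable_tail X s : clock_process X ->
  measurable_fun setT (fun t : R => tail X (Num.max 0 t)%R s).
Proof.
move=> cX; apply: measurable_tail_comp => //; first exact: measurable_maxr.
by move=> t; rewrite le_max lexx.
Qed.

(** [X] at an independent exponential time of rate [z] is exponential of rate
    [z `^ b]. *)
Definition tail_exponent X (b : R) := forall z s : R, (0 < z)%R -> (0 <= s)%R ->
  laplace z (tail X ^~ s) = (expR (- (s * z `^ b)))%:E.

Lemma tail_exponent_id : tail_exponent (fun t _ => t) 1.
Proof.
move=> z s z0 s0; rewrite powRr1 ?(ltW z0) // -laplace_tail_id //.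
apply: eq_laplace => t t0; rewrite indicE mem_setE in_itv /= andbT /tail.
case: (leP s t) => _; first by rewrite set_true probability_setT.
by rewrite set_false measure0.
Qed.

(** By Tonelli the exponential time can be integrated out first; at the fixed
    level [U w] the transform of the tail of [S] is known. *)
Lemma laplace_below_tail S b (U : T -> R) (z : R) : clock_process S ->
  tail_exponent S b -> (0 < z)%R -> measurable_fun setT U ->
  (forall w, (0 <= U w)%R) ->
  laplace z (fun t => \int[P]_w P [set w' | (U w' <= S t w)%R]) =
  \int[P]_w (expR (- (z `^ b * U w)))%:E.
Proof.
move=> cS hS z0 mU U0; rewrite /laplace.
have m0 (t : R) : (0 <= Num.max 0 t)%R by rewrite le_max lexx.
have pdf0 t : 0 <= (exponential_pdf z t)%:E.
  by rewrite lee_fin exponential_pdf_ge0 // ltW.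
transitivity (\int[mu]_t \int[P]_w
    ((exponential_pdf z t)%:E * tail S (Num.max 0 t)%R (U w))).
  apply: eq_integral => t _; rewrite le_probability_swap //; last first.
    exact: cS.1.
  rewrite ge0_integralZl //.
  by apply: measurable_tail_comp => //; exact: measurable_cst.
rewrite (@fubini_tonelli _ _ _ _ _ mu P (fun x : R * T =>
   (exponential_pdf z x.1)%:E * tail S (Num.max 0 x.1)%R (U x.2))) /=.
- apply: eq_integral => w _; rewrite [LHS]hS ?U0 //.
  by rewrite mulrC.
- apply: emeasurable_funM.
    apply/measurable_EFinP; apply: measurableT_comp => //.
    exact: measurable_exponential_pdf.
  apply: measurable_tail_comp => //; last exact: measurableT_comp.
  by apply: measurable_maxr => //.
- by move=> x; rewrite mule_ge0.
Qed.

(** [D] is the process inverse to [X]. The events [s <= X v] and [D s <= v]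
    may differ by a jump of [D] at [s], whence the two-sided comparison with
    [D s] and with [D r] for [r < s]. Only the law of [D s] matters: it enters
    after the tail of [X] has been averaged over [S t]. *)
Lemma tail_exponent_comp X S (D : R -> T -> R) b1 b2 :
  clock_process X -> clock_process S ->
  (forall s, (0 <= s)%R -> measurable_fun setT (D s)) ->
  (forall s w, (0 <= s)%R -> (0 <= D s w)%R) ->
  (forall s v, (0 <= s)%R -> (0 <= v)%R ->
     P [set w | (D s w <= v)%R] <= tail X v s) ->
  (forall r s v, (0 <= r)%R -> (r < s)%R -> (0 <= v)%R ->
     tail X v s <= P [set w | (D r w <= v)%R]) ->
  (forall s z, (0 <= s)%R -> (0 < z)%R ->
     \int[P]_w (expR (- (z * D s w)))%:E = (expR (- (s * z `^ b1)))%:E) ->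
  (forall s t, (0 <= t)%R ->
     tail (fun t w => X (S t w) w) t s = \int[P]_w tail X (S t w) s) ->
  tail_exponent S b2 -> tail_exponent (fun t w => X (S t w) w) (b1 * b2).
Proof.
move=> cX cS mD D0 DX XD lD ind hS z s z0 s0.
have cXS := clock_process_comp cX cS.
have S0 t w : (0 <= t)%R -> (0 <= S t w)%R.
  by move=> t0; case: (cS.2 w) => + _ _; apply.
have zb : (0 < z `^ b2)%R by exact: powR_gt0.
have mDS r (t : R) : (0 <= r)%R -> (0 <= t)%R ->
    measurable_fun setT (fun w => P [set w' | (D r w' <= S t w)%R]).
  move=> r0 t0; apply: measurable_fun_ge_probability; first exact: mD.
  exact: cS.1.
have mlD r : (0 <= r)%R -> measurable_fun setT
    (fun t : R => \int[P]_w P [set w' | (D r w' <= S (Num.max 0 t)%R w)%R]).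
  move=> r0.
  have m0 (t : R) : (0 <= Num.max 0 t)%R by rewrite le_max lexx.
  rewrite (_ : (fun t => _) = fubini_F P
      (fun x : R * T => tail S (Num.max 0 x.1)%R (D r x.2))).
    apply: measurable_fun_fubini_tonelli_F => //.
    apply: measurable_tail_comp => //; first exact: measurable_maxr.
    by apply: measurableT_comp => //; exact: mD.
  apply/funext => t; rewrite /fubini_F le_probability_swap //; first exact: mD.
  exact: cS.1.
have mXS t : (0 <= t)%R -> measurable_fun setT (fun w => tail X (S t w) s).
  move=> t0; apply: measurable_tail_comp => //; first exact: cS.1.
  by move=> w; exact: S0.
have lower : (expR (- (s * z `^ (b1 * b2))))%:E <=
    laplace z (tail (fun t w => X (S t w) w) ^~ s).
  rewrite (mulrC b1) powRrM -(lD _ _ s0 zb) -(laplace_below_tail cS hS z0 (mD _ s0)).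
    apply: le_laplace => //.
    - exact: mlD.
    - exact: measurable_tail.
    - by move=> v v0; apply: integral_ge0.
    - move=> v v0; rewrite ind //; apply: ge0_le_integral => //.
      + exact: mDS.
      + exact: mXS.
      + by move=> w _; apply: DX => //; exact: S0.
  by move=> w; exact: D0.
have upper r : (0 <= r)%R -> (r < s)%R ->
    laplace z (tail (fun t w => X (S t w) w) ^~ s) <=
    (expR (- (r * z `^ (b1 * b2))))%:E.
  move=> r0 rs; rewrite (mulrC b1) powRrM -(lD _ _ r0 zb).
  rewrite -(laplace_below_tail cS hS z0 (mD _ r0)).
    apply: le_laplace => //.
    - exact: measurable_tail.
    - exact: mlD.
    - move=> v v0; rewrite ind //; apply: ge0_le_integral => //.
      + exact: mXS.
      + exact: mDS.
      + by move=> w _; apply: XD => //; exact: S0.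
  by move=> w; exact: D0.
set c := (z `^ (b1 * b2))%R in lower upper *.
have c0 : (0 <= c)%R by exact: powR_ge0.
apply/eqP; rewrite eq_le lower andbT.
have [{}s0|s00] := ltP 0%R s; last first.
  have -> : s = 0%R by lra.
  rewrite mul0r oppr0 expR0 -(laplace_cst1 z0).
  apply: le_laplace => //; first exact: measurable_tail.
  by move=> v v0; exact: tail_le1.
apply/lee_addgt0Pr => e e0.
(* With r := s - y and y small, the upper bound exceeds the lower by at most e. *)
pose y := Num.min s (e / (c + 1))%R.
have y0 : (0 < y)%R by rewrite lt_min s0 divr_gt0 // ltr_pwDr.
have yc : (y * c <= e)%R.
  have : (y * (c + 1) <= e)%R.
    rewrite -ler_pdivlMr; first by rewrite ge_min lexx orbT.
    by rewrite ltr_pwDr.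
  by lra.
have ys : (y <= s)%R by rewrite ge_min lexx.
have := upper (s - y)%R ltac:(lra) ltac:(lra).
move=> /le_trans; apply; rewrite -EFinD lee_fin.
have := expR_ge1Dx (- (y * c))%R.
have -> : (- (s * c) = - (y * c) + - ((s - y) * c))%R by ring.
rewrite expRD.
have : (expR (- ((s - y) * c)) <= 1)%R.
  by rewrite -expR0 ler_expR oppr_le0 mulr_ge0 //; lra.
have := expR_gt0 (- ((s - y) * c))%R.
by nra.
Qed.

End tails.

(** * Upper bounds on tails and exponential moments *)

Section exponential_moments.
Context d (T : measurableType d) (R : realType) (P : probability T R).
Local Notation mu := (@lebesgue_measure R).
Variables (X : R -> T -> R) (b : R).
Hypotheses (cX : clock_process X) (Xb : tail_exponent P X b).

(** The tail is nondecreasing in time, so its transform at rate [z] is at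
    least its value at [t] times the probability that an exponential time
    exceeds [t]. *)
Lemma tail_chernoff z t s : 0 < z -> 0 <= t -> 0 <= s ->
  (tail P X t s <= (expR (z * t - s * z `^ b))%:E)%E.
Proof.
move=> z0 t0 s0.
have F0 : (0 <= tail P X t s)%E by [].
have Ffin : tail P X t s \is a fin_num.
  by rewrite fin_num_measure //; exact: measurable_tail_event.
have : (laplace z (fun v => (\1_(`[t, +oo[%classic : set R) v)%:E * tail P X t s)
    <= laplace z (tail P X ^~ s))%E.
  apply: le_laplace => //.
  - apply: emeasurable_funM => //; apply/measurable_EFinP.
    by apply: measurableT_comp => //; exact: measurable_maxr.
  - exact: measurable_tail.
  - by move=> v v0; rewrite mule_ge0 // lee_fin.
  - move=> v v0; rewrite indicE mem_setE in_itv /= andbT.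
    case: (leP t v) => tv; rewrite ?mul1e ?mul0e //.
    exact: tail_nondecreasing.
rewrite Xb //.
have -> : laplace z (fun v => (\1_(`[t, +oo[%classic : set R) v)%:E * tail P X t s)%E
    = ((expR (- (t * z)))%:E * tail P X t s)%E.
  rewrite -(laplace_tail_id z0 t0) /laplace muleC -ge0_integralZl //.
  - by apply: eq_integral => v _; rewrite [RHS]muleC muleA.
  - refine (measurable_laplace_integrand
      (f := fun v => (\1_(`[t, +oo[%classic : set R) v)%:E) z _).
    apply/measurable_EFinP; apply: measurableT_comp => //.
    exact: measurable_maxr.
  - move=> v _; apply: mule_ge0; rewrite lee_fin // exponential_pdf_ge0 //.
    exact: ltW.
rewrite -(fineK Ffin) -EFinM !lee_fin => h.
rewrite expRD (mulrC z) -ler_pdivrMl ?expR_gt0 // -expRN.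
exact: h.
Qed.

Lemma nneseries_geometric_le (c q : R) : 0 <= c -> 0 <= q < 1 ->
  (\sum_(0 <= j <oo) (c * q ^+ j)%:E <= (c / (1 - q))%:E)%E.
Proof.
move=> c0 /andP[q0 q1]; apply: lime_le.
  by apply: is_cvg_nneseries => j _ _; rewrite lee_fin mulr_ge0 // exprn_ge0.
apply: nearW => n; rewrite sumEFin lee_fin.
have -> : \sum_(0 <= j < n) c * q ^+ j = c * (1 - q ^+ n) / (1 - q).
  have := @geometric_seriesE R c q; rewrite lt_eqF // => /(_ isT) /(congr1 (fun u => u n)).
  by [].
rewrite ler_pM2r ?invr_gt0 ?subr_gt0 // ler_piMr // gerBl.
exact: exprn_ge0.
Qed.

(** On [j <= y * X < j + 1] the exponential is at most [exp (j + 1)]. The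
    Chernoff bound at the rate whose power [b] is [y + e] makes the resulting
    series geometric, of ratio [exp (- e / y)]. *)
Lemma exp_moment_le t y e : 0 < b -> 0 <= t -> 0 < y -> 0 < e ->
  (\int[P]_w (expR (y * X t w))%:E <=
   (expR (1 + (y + e) `^ b^-1 * t) * (1 + y / e))%:E)%E.
Proof.
move=> b0 t0 y0 e0.
pose z := (y + e) `^ b^-1.
have z0 : 0 < z by apply: powR_gt0; lra.
have zb : z `^ b = y + e.
  by rewrite /z -powRrM mulVf ?gt_eqF // powRr1 //; lra.
pose V w := y * X t w.
have mX : measurable_fun setT (X t) by exact: cX.1.
have mV : measurable_fun setT V by exact: measurable_funM.
have V0 w : 0 <= V w.
  by rewrite mulr_ge0 ?(ltW y0) //; case: (cX.2 w) => + _ _; apply.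
pose J w := cell 0 (V w).
have JP w : (J w)%:R <= V w /\ V w < (J w).+1%:R.
  have /(cell_eq _ _ (V0 w)) := erefl (J w).
  by rewrite /= in_itv /= /cell_end !divr1 => /andP.
have mJ : measurable_fun setT J by exact: measurable_cell.
pose q := expR (- (e / y)).
have q0 : 0 < q by exact: expR_gt0.
have ey : 0 < e / y by exact: divr_gt0.
have qle : q <= (1 + e / y)^-1.
  by rewrite /q expRN lef_pV2 ?posrE ?expR_gt0 //; [exact: expR_ge1Dx|lra].
have q1 : q < 1 by apply: le_lt_trans qle _; rewrite invf_lt1; lra.
apply: (@le_trans _ _ (\int[P]_w (expR (J w).+1%:R)%:E)%E).
  apply: ge0_le_integral => //.
  - by apply/measurable_EFinP; apply: measurableT_comp.
  - apply: (measurable_fun_countable_subst (F := fun j => cst (expR j.+1%:R)%:E)) => //.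
  - by move=> w _; rewrite lee_fin ler_expR; have [_ /ltW] := JP w.
rewrite (@integral_countable_subst _ _ _ P (fun j => (expR j.+1%:R)%:E)) //.
apply: (@le_trans _ _ (\sum_(0 <= j <oo) (expR (1 + z * t) * q ^+ j)%:E)%E).
  apply: lee_nneseries => [j _ _|j _].
    by rewrite mule_ge0 // lee_fin expR_ge0.
  apply: (@le_trans _ _ ((expR j.+1%:R)%:E * tail P X t (j%:R / y))%E).
    apply: lee_wpmul2l; first by rewrite lee_fin expR_ge0.
    apply: le_measure.
    - by rewrite inE; exact: measurable_preimage_nat.
    - by rewrite inE; exact: measurable_tail_event.
    - move=> w /= <-; rewrite ler_pdivrMr // mulrC.
      by have [] := JP w.
  have jy : 0 <= j%:R / y by apply: divr_ge0 => //; exact: ltW.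
  apply: le_trans (lee_wpmul2l _ (tail_chernoff z0 t0 jy)) _.
    by rewrite lee_fin expR_ge0.
  rewrite -EFinM lee_fin zb /q -expRM_natl -!expRD ler_expR -natr1.
  by rewrite le_eqVlt; apply/orP; left; apply/eqP; field; rewrite gt_eqF.
apply: le_trans (nneseries_geometric_le (expR_ge0 _) _) _.
  by rewrite ltW.
rewrite lee_fin; apply: ler_wpM2l; first exact: expR_ge0.
rewrite -[leLHS]mul1r ler_pdivrMr ?subr_gt0 //.
have : (1 + y / e) * q <= (1 + y / e) * (1 + e / y)^-1.
  by apply: ler_wpM2l => //; have := divr_gt0 y0 e0; lra.
have -> : (1 + y / e) * (1 + e / y)^-1 = y / e.
  by field; rewrite !gt_eqF //=; lra.
by lra.
Qed.

(** Exponential tilting. Between [t1] and [t0] the tail is at most its value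
    at [t0]; before [t1] the density of rate [z] is dominated by a multiple of
    the one of rate [z2], and after [t0] by a multiple of the one of rate
    [z1]. *)
Lemma tail_exponent_window z z1 z2 t1 t0 s :
  0 < z1 -> z1 < z -> z < z2 -> 0 <= t1 -> 0 <= t0 -> 0 <= s ->
  expR (- (s * z `^ b)) <=
    fine (tail P X t0 s) * expR (- (t1 * z)) +
    z / z1 * expR (- ((z - z1) * t0)) * expR (- (s * z1 `^ b)) +
    z / z2 * expR ((z2 - z) * t1) * expR (- (s * z2 `^ b)).
Proof.
move=> z10 z1z zz2 t10 t00 s0.
have z0 : 0 < z by lra.
have z20 : 0 < z2 by lra.
set c1 := fine _; set c2 := z / z1 * _; set c3 := z / z2 * _.
have Ffin v : 0 <= v -> tail P X v s \is a fin_num.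
  by move=> v0; rewrite fin_num_measure //; exact: measurable_tail_event.
have c10 : 0 <= c1 by rewrite fine_ge0.
have c20 : 0 <= c2.
  by rewrite mulr_ge0 ?expR_ge0 // divr_ge0 // ltW.
have c30 : 0 <= c3.
  by rewrite mulr_ge0 ?expR_ge0 // divr_ge0 // ltW.
pose I := fun v : R => (\1_(`[t1, +oo[%classic : set R) v)%:E : \bar R.
pose F := tail P X ^~ s.
have pdf0 u (v : R) : 0 < u -> (0 <= (exponential_pdf u v)%:E)%E.
  by move=> u0; rewrite lee_fin exponential_pdf_ge0 // ltW.
have mI : measurable_fun setT (fun v : R => I (Num.max 0 v)).
  apply/measurable_EFinP; apply: measurableT_comp => //.
  exact: measurable_maxr.
have mF : measurable_fun setT (fun v : R => F (Num.max 0 v)) by exact: measurable_tail.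
have mI' := measurable_laplace_integrand z mI.
have mF' u := measurable_laplace_integrand u mF.
have I0 (u v : R) : 0 < u -> (0 <= (exponential_pdf u v)%:E * I (Num.max 0 v)%R)%E.
  by move=> u0; rewrite mule_ge0 ?pdf0 // lee_fin.
have F0 (u v : R) : 0 < u -> (0 <= (exponential_pdf u v)%:E * F (Num.max 0 v)%R)%E.
  by move=> u0; rewrite mule_ge0 ?pdf0.
have : (laplace z F <= c1%:E * laplace z I + c2%:E * laplace z1 F +
    c3%:E * laplace z2 F)%E.
  have cI v : (0 <= c1%:E * ((exponential_pdf z v)%:E * I (Num.max 0 v)%R))%E.
    by rewrite mule_ge0 ?I0.
  have cF c u v : 0 <= c -> 0 < u ->
      (0 <= c%:E * ((exponential_pdf u v)%:E * F (Num.max 0 v)%R))%E.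
    by move=> ? ?; rewrite mule_ge0 ?F0.
  have mcI := measurable_funeM c1%:E mI'.
  have mcF c u := measurable_funeM c%:E (mF' u).
  have cI3 v : (0 <= c1%:E * ((exponential_pdf z v)%:E * I (Num.max 0 v)%R) +
      c2%:E * ((exponential_pdf z1 v)%:E * F (Num.max 0 v)%R))%E.
    by rewrite adde_ge0 ?cF.
  have m3 := emeasurable_funD mcI (mcF c2 z1).
  have eI : (c1%:E * laplace z I = \int[mu]_v
      (c1%:E * ((exponential_pdf z v)%:E * I (Num.max 0 v)%R)))%E.
    by rewrite /laplace -ge0_integralZl ?lee_fin // => v _; exact: I0.
  have eF c u : 0 <= c -> 0 < u -> (c%:E * laplace u F = \int[mu]_v
      (c%:E * ((exponential_pdf u v)%:E * F (Num.max 0 v)%R)))%E.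
    by move=> ? ?; rewrite /laplace -ge0_integralZl ?lee_fin //; [exact: mF'|move=> v _; exact: F0].
  rewrite eI !eF // -ge0_integralD //; last 2 first.
  - by move=> v _; exact: cF.
  - exact: mcF.
  rewrite -ge0_integralD //; last 2 first.
  - by move=> v _; exact: cF.
  - exact: mcF.
  apply: ge0_le_integral => //.
  - by move=> v _; exact: F0.
  - exact: mF'.
  - exact: (emeasurable_funD m3 (mcF c3 z2)).
  move=> v _.
  have [v0|v0] := ltP v 0.
    by rewrite !lt0_exponential_pdf // !mul0e !mule0 !adde0.
  rewrite !exponential_pdfE // /F /I indicE mem_setE in_itv /= andbT.
  rewrite -(fineK (Ffin v v0)).
  set f := fine _.
  have f0 : 0 <= f by rewrite fine_ge0.
  have f1 : f <= 1.
    by rewrite -lee_fin fineK ?Ffin //; exact: tail_le1.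
  rewrite -!EFinM -!EFinD lee_fin.
  set A := c1 * _; set B := c2 * _; set C := c3 * _.
  have A0 : 0 <= A by apply: mulr_ge0 => //; rewrite !mulr_ge0 ?expR_ge0 // ltW.
  have B0 : 0 <= B by apply: mulr_ge0 => //; rewrite !mulr_ge0 ?expR_ge0 // ltW.
  have C0 : 0 <= C by apply: mulr_ge0 => //; rewrite !mulr_ge0 ?expR_ge0 // ltW.
  have [vt1|t1v] := ltP v t1.
    suff : z * expR (- z * v) * f <= C by lra.
    rewrite /C /c3 !mulrA; apply: ler_wpM2r => //.
    rewrite -!mulrA; apply: ler_wpM2l; first exact: ltW.
    rewrite (_ : z2^-1 * _ = expR ((z2 - z) * t1) * expR (- z2 * v)); last first.
      by field; rewrite gt_eqF.
    by rewrite -expRD ler_expR; nra.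
  have [vt0|t0v] := ltP v t0.
    suff : z * expR (- z * v) * f <= A by lra.
    rewrite /A t1v mulr1 mulrC; apply: ler_wpM2r; first by rewrite mulr_ge0 ?expR_ge0 // ltW.
    rewrite -lee_fin !fineK ?Ffin //; apply: tail_nondecreasing => //.
    exact: ltW.
  suff : z * expR (- z * v) * f <= B by lra.
  rewrite /B /c2 !mulrA; apply: ler_wpM2r => //.
  rewrite -!mulrA; apply: ler_wpM2l; first exact: ltW.
  rewrite (_ : z1^-1 * _ = expR (- ((z - z1) * t0)) * expR (- z1 * v)); last first.
    by field; rewrite gt_eqF.
  by rewrite -expRD ler_expR; nra.
rewrite /F !Xb // (laplace_tail_id z0 t10) -!EFinM -!EFinD lee_fin.
by [].
Qed.

End exponential_moments.

(** * Lower bounds on tails and exponential moments *)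

Section lower_moment.
Context d (T : measurableType d) (R : realType) (P : probability T R).
Local Notation mu := (@lebesgue_measure R).
Variables (X : R -> T -> R) (b : R).
Hypotheses (cX : clock_process X) (Xb : tail_exponent P X b).

(** For this [s] the exponential tilting of rate [x] concentrates the time
    near [rho * t], inside the window from [rho ^+ 2 * t] to [t]. The two
    error terms of [tail_exponent_window] at the rates [x * (1 - eta)] and [x
    * (1 + eta)] are then exponentially small in [x]. *)
Lemma tail_ge t rho : 0 < t -> 0 < rho < 1 -> 0 < b < 1 ->
  exists2 x0, 0 < x0 & forall x s, x0 <= x -> s = rho * t * x `^ (1 - b) / b ->
    2^-1 * expR (rho ^+ 2 * t * x - s * x `^ b) <= fine (tail P X t s).
Proof.
move=> t0 /andP[rho0 rho1] /[dup] hb /andP[b0 b1].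
(* The times rho * t / (1 - eta) and rho * t / (1 + eta), around which the
   perturbed rates concentrate, lie strictly between rho ^+ 2 * t and t. *)
pose eta := (1 - rho) / 2.
have rhoE : rho = 1 - 2 * eta by rewrite /eta; field.
have eta0 : 0 < eta by rewrite /eta; lra.
have eta1 : eta < 2^-1 by rewrite /eta; lra.
have ie0 : 0 <= (1 - eta)^-1 by rewrite invr_ge0; lra.
have ie1 : (1 - eta)^-1 <= 2 by rewrite invf_ple ?posrE //; lra.
have ie2 : 0 <= (1 + eta)^-1 by rewrite invr_ge0; lra.
have ie3 : (1 + eta)^-1 <= 1 by rewrite invf_le1; lra.
pose A := eta ^+ 2 * t.
pose B := eta ^+ 2 * rho * t / 2.
have e2 : 0 < eta ^+ 2 by exact: exprn_gt0.
have A0 : 0 < A by exact: mulr_gt0.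
have B0 : 0 < B by apply: divr_gt0 => //; apply: mulr_gt0 => //; exact: mulr_gt0.
pose x0 := 8 / A + 4 / B.
have x00 : 0 < x0 by rewrite addr_gt0 // divr_gt0.
exists x0 => // x s x0x sE.
have x_gt0 : 0 < x by lra.
have s0 : 0 < s by rewrite sE !mulr_gt0 ?powR_gt0 ?invr_gt0.
have xbb : x `^ (1 - b) * x `^ b = x.
  rewrite -powRD; last by rewrite (gt_eqF x_gt0) implybT.
  by rewrite subrK powRr1 // ltW.
have sxb : s * (b * x `^ b) = rho * t * x.
  by rewrite sE -[in RHS]xbb; field; rewrite gt_eqF.
have smallA : expR (- (A * x)) <= 9^-1.
  rewrite expRN lef_pV2 ?posrE ?expR_gt0 //.
  apply: le_trans (expR_ge1Dx _).
  have : A * x0 <= A * x by rewrite ler_pM2l.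
  have -> : A * x0 = 8 + 4 * (A / B) by rewrite /x0; field; rewrite !gt_eqF.
  by have := divr_gt0 A0 B0; lra.
have smallB : expR (- (B * x)) <= 5^-1.
  rewrite expRN lef_pV2 ?posrE ?expR_gt0 //.
  apply: le_trans (expR_ge1Dx _).
  have : B * x0 <= B * x by rewrite ler_pM2l.
  have -> : B * x0 = 4 + 8 * (B / A) by rewrite /x0; field; rewrite !gt_eqF.
  by have := divr_gt0 B0 A0; lra.
pose t1 := rho ^+ 2 * t.
have xe : 0 < x * eta by exact: mulr_gt0.
have xe1 : 0 < x * (1 - eta) by apply: mulr_gt0 => //; lra.
have t10 : 0 <= t1 by rewrite /t1 mulr_ge0 ?exprn_ge0 // ltW.
have := @tail_exponent_window _ _ _ P X b cX Xb x (x * (1 - eta)) (x * (1 + eta)) t1 t s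
  ltac:(lra) ltac:(lra) ltac:(lra) t10 (ltW t0) (ltW s0).
set F := fine _.
have -> : x / (x * (1 - eta)) = (1 - eta)^-1 by field; rewrite !gt_eqF //; lra.
have -> : x / (x * (1 + eta)) = (1 + eta)^-1 by field; rewrite !gt_eqF //; lra.
set G := expR (- (s * x `^ b)).
have G0 : 0 < G by exact: expR_gt0.
pose e3 := eta ^+ 3 * x * t.
have lowtail : expR (- ((x - x * (1 - eta)) * t)) * expR (- (s * (x * (1 - eta)) `^ b))
    <= expR (- (A * x)) * G.
  rewrite -!expRD ler_expR.
  have := powR_diff_below x_gt0 (eta := eta) ltac:(lra) hb.
  move=> /(ler_wpM2l (ltW s0)).
  have -> : s * (b * eta * x `^ b / (1 - eta)) = (s * (b * x `^ b)) * (eta / (1 - eta)).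
    by ring.
  rewrite sxb.
  have : rho * t * x * (eta / (1 - eta)) <= eta * x * t - A * x.
    rewrite mulrA ler_pdivrMr; last lra.
    have -> : (eta * x * t - A * x) * (1 - eta) = rho * t * x * eta + e3.
      by rewrite /e3 /A rhoE; ring.
    rewrite lerDl; apply: mulr_ge0 (ltW t0); apply: mulr_ge0 (ltW x_gt0).
    by apply: exprn_ge0; exact: ltW.
  by lra.
have hightail : expR ((x * (1 + eta) - x) * t1) * expR (- (s * (x * (1 + eta)) `^ b))
    <= expR (- (B * x)) * G.
  rewrite -!expRD ler_expR.
  have := powR_diff_above x_gt0 eta0 hb.
  move=> /(ler_wpM2l (ltW s0)).
  have -> : s * (b * eta * x `^ b / (1 + eta)) = (s * (b * x `^ b)) * (eta / (1 + eta)).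
    by ring.
  rewrite sxb.
  have : eta * x * t1 + B * x <= rho * t * x * (eta / (1 + eta)).
    rewrite [leRHS]mulrA ler_pdivlMr; last lra.
    rewrite /B /t1.
    have -> : (eta * x * (rho ^+ 2 * t) + eta ^+ 2 * rho * t / 2 * x) * (1 + eta) =
      rho * t * x * eta * ((rho + eta / 2) * (1 + eta)) by ring.
    have -> : (rho + eta / 2) * (1 + eta) = 1 - eta / 2 - 3 / 2 * eta ^+ 2.
      by rewrite rhoE; field.
    apply: ler_piMr; last by lra.
    by apply: mulr_ge0; [rewrite !mulr_ge0 ?ltW|exact: ltW].
  by lra.
move=> win.
have {}win : G <= F * expR (- (t1 * x)) + 2 * (9^-1 * G) + 5^-1 * G.
  apply: le_trans win _; apply: lerD; first apply: lerD => //.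
    rewrite -mulrA; apply: ler_pM.
    - exact: ie0.
    - by rewrite mulr_ge0 ?expR_ge0.
    - exact: ie1.
    - by apply: le_trans lowtail _; rewrite ler_pM2r.
  rewrite -mulrA -[leRHS]mul1r; apply: ler_pM.
  - exact: ie2.
  - by rewrite mulr_ge0 ?expR_ge0.
  - exact: ie3.
  - by apply: le_trans hightail _; rewrite ler_pM2r.
rewrite expRD -/G -ler_pdivlMl // ?invr_gt0 // invrK.
rewrite -(ler_pM2r (expR_gt0 (- (t1 * x)))).
rewrite -/t1 mulrC mulrA -expRD addNr expR0 mul1r.
by lra.
Qed.

(** Markov's inequality at the level [s] of [tail_ge]. At the rate [x] with [x
    `^ b = y] the gain [exp (y * s)] cancels the loss [exp (- s * x `^ b)],
    and only the tilting factor remains. *)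
Lemma exp_moment_ge t rho : 0 < t -> 0 < rho < 1 -> 0 < b < 1 ->
  exists y0, forall y, y0 <= y ->
   ((2^-1 * expR (rho ^+ 2 * t * y `^ b^-1))%:E <=
    \int[P]_w (expR (y * X t w))%:E)%E.
Proof.
move=> t0 hrho /[dup] hb /andP[b0 b1].
have [x0 x00 hx0] := tail_ge t0 hrho hb.
exists (x0 `^ b) => y yx0.
have y0 : 0 < y by apply: lt_le_trans yx0; exact: powR_gt0.
pose x := y `^ b^-1.
have xb : x `^ b = y by rewrite /x -powRrM mulVf ?gt_eqF // powRr1 // ltW.
have x0x : x0 <= x.
  have -> : x0 = (x0 `^ b) `^ b^-1.
    by rewrite -powRrM mulfV ?gt_eqF // powRr1 // ltW.
  by apply: ge0_ler_powR; rewrite ?nnegrE ?powR_ge0 ?invr_ge0 ?(ltW b0) ?(ltW y0).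
pose s := rho * t * x `^ (1 - b) / b.
have hs := hx0 x s x0x erefl.
have mX : measurable_fun setT (X t) by apply: cX.1; exact: ltW.
have tfin : tail P X t s \is a fin_num.
  by rewrite fin_num_measure //; apply: measurable_tail_event => //; exact: ltW.
apply: (@le_trans _ _ ((expR (y * s))%:E * tail P X t s)%E).
  rewrite -(fineK tfin) -EFinM lee_fin.
  apply: le_trans (ler_wpM2l (expR_ge0 _) hs).
  by rewrite mulrCA -expRD xb; apply: ler_wpM2l => //; rewrite ler_expR -/x; lra.
have mE : measurable [set w | s <= X t w].
  by apply: measurable_tail_event => //; exact: ltW.
rewrite /tail -[X in P X]setIT -(@integral_indic _ _ _ P setT measurableT _ mE).
have mI : measurable_fun setT (fun w => (\1_[set w | s <= X t w] w)%:E : \bar R).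
  by apply/measurable_EFinP; exact: measurable_indic.
rewrite -ge0_integralZl //.
  apply: ge0_le_integral => //.
  - exact: emeasurable_funM.
  - apply/measurable_EFinP; apply: measurableT_comp => //.
    exact: measurable_funM.
  - move=> w _; rewrite -EFinM lee_fin indicE.
    case: (boolP (w \in _)); rewrite ?mulr0 ?expR_ge0 // mulr1 inE /= => sX.
    by rewrite ler_expR ler_pM2l.
Qed.

End lower_moment.

(** * First passage times and null sets *)

Section first_passage_clock.
Context {R : realType}.
Implicit Types (x y : R -> R) (s t r v : R).

Lemma eq_clock x y : (forall t, 0 <= t -> x t = y t) -> clock x -> clock y.
Proof.
move=> xy [x0 xnd xrc]; split.
- by move=> t t0; rewrite -xy // x0.
- move=> s t s0 st; rewrite -!xy //; first exact: xnd.
  exact: le_trans st.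
- move=> t e t0 e0; have [v tv xv] := xrc t e t0 e0.
  by exists v => //; rewrite -!xy // (le_trans t0) // ltW.
Qed.

Lemma nondecreasing_cadlag_clock x : nondecreasing_cadlag x ->
  (forall t, 0 <= t -> 0 <= x t) -> clock x.
Proof.
move=> [xnd xrc] x0; split => // t e t0 e0.
have /cvgrPdist_lt /(_ e e0) := xrc t t0.
move=> /(filterI (nbhs_right_gt t)) /filter_ex [v [tv]].
rewrite ltr_norml => /andP[h _].
by exists v => //; lra.
Qed.

Variable x : R -> R.
Hypotheses (x0 : x 0 = 0) (xnd : forall s t, 0 <= s -> s <= t -> x s <= x t).
Hypothesis xy : forall M : R, exists2 s, 0 <= s & M < x s.

Let A t := [set s | 0 < s /\ t < x s].

Let A_neq0 t : 0 <= t -> A t !=set0.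
Proof.
move=> t0; have [s s0 ts] := xy t; exists s; split => //.
rewrite lt_neqAle s0 andbT; apply/eqP => s0'.
by move: ts; rewrite -s0' x0 ltNge t0.
Qed.

Let A_lb t : has_lbound (A t).
Proof. by exists 0 => s [/ltW]. Qed.

Lemma first_passage_le t s : 0 < s -> t < x s -> first_passage x t <= s.
Proof. by move=> s0 ts; apply: ge_inf => //; exact: A_lb. Qed.

(** For right continuity: some [s] close to the infimum at level [t] has [t <
    x s], and this [s] still witnesses every level below [x s]. *)
Lemma first_passage_clock : clock (first_passage x).
Proof.
split.
- by move=> t t0; apply: lb_le_inf; [exact: A_neq0|move=> s [/ltW]].
- move=> s t s0 st; apply: lb_le_inf; first by apply: A_neq0; exact: le_trans st.
  by move=> r [r0 tr]; apply: first_passage_le => //; exact: le_lt_trans tr.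
- move=> t e t0 e0.
  have [|s [s0 ts] sle] := @inf_adherent _ (A t) e e0.
    by split; [exact: A_neq0|exact: A_lb].
  exists ((t + x s) / 2); first by lra.
  by apply: le_lt_trans sle; apply: first_passage_le => //; lra.
Qed.

Lemma le_first_passage s v : 0 <= s -> 0 <= v -> x s <= v -> s <= first_passage x v.
Proof.
move=> s0 v0 sv; apply: lb_le_inf; first exact: A_neq0.
move=> r [r0 vr]; rewrite leNgt; apply/negP => rs.
by have := xnd (ltW r0) (ltW rs); rewrite leNgt (le_lt_trans sv vr).
Qed.

Lemma lt_first_passage r s v : 0 <= r -> 0 <= v -> r < s ->
  s <= first_passage x v -> x r <= v.
Proof.
move=> r0 v0 rs sv; rewrite leNgt; apply/negP => vr.
have r_gt0 : 0 < r.
  rewrite lt_neqAle r0 andbT; apply/eqP => r0'.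
  by move: vr; rewrite -r0' x0 ltNge v0.
by have := first_passage_le r_gt0 vr; rewrite leNgt (lt_le_trans rs sv).
Qed.

End first_passage_clock.

Section null_sets.
Context d (T : measurableType d) (R : realType) (P : probability T R).
Implicit Types (M A B : set T) (X : R -> T -> R).

Lemma le_probability_off_null M A B : measurable M -> P M = 0%E ->
  measurable A -> measurable B -> A `\` M `<=` B -> (P A <= P B)%E.
Proof.
move=> mM M0 mA mB AB.
apply: (@le_trans _ _ (P (B `|` M))).
  apply: le_measure; rewrite ?inE //; first exact: measurableU.
  by move=> w Aw; have [Mw|Mw] := pselect (M w); [right|left; exact: AB].
apply: le_trans (measureU2 _ _ _) _ => //.
by rewrite [X in (_ + X)%E](_ : _ = 0%E) ?adde0.
Qed.

Lemma eq_probability_off_null M A B : measurable M -> P M = 0%E ->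
  measurable A -> measurable B -> (forall w, ~ M w -> A w <-> B w) -> P A = P B.
Proof.
move=> mM M0 mA mB AB; apply/eqP; rewrite eq_le.
by apply/andP; split; apply: (le_probability_off_null mM M0) => // w [h /AB [h1 h2]];
  auto.
Qed.

Lemma probability_bigcup0 (I : countType) (A : I -> set T) :
  (forall i, measurable (A i)) -> (forall i, P (A i) = 0%E) ->
  measurable (\bigcup_i A i) /\ P (\bigcup_i A i) = 0%E.
Proof.
move=> mA A0; pose B n := if unpickle n is Some i then A i else set0.
have -> : \bigcup_i A i = \bigcup_n B n.
  apply/seteqP; split => [w [i _ Ai]|w [n _]].
    by exists (pickle i) => //; rewrite /B pickleK.
  by rewrite /B; case: unpickle => // i Ai; exists i.
have mB n : measurable (B n) by rewrite /B; case: unpickle.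
split; first exact: bigcup_measurable.
apply/negligibleP; first exact: bigcup_measurable.
apply: negligible_bigcup => n; apply/(negligibleP _ (mB n)).
by rewrite /B; case: unpickle => // ; exact: measure0.
Qed.

(** Path properties that hold almost surely hold everywhere once the process
    is made constant on a null set. *)
Definition vanish_on M X (t : R) (w : T) : R := \1_(~` M) w * X t w.

Lemma vanish_onE M X t w : ~ M w -> vanish_on M X t w = X t w.
Proof. by move=> Mw; rewrite /vanish_on indicE mem_set // mul1r. Qed.

Lemma vanish_on0 M X t w : M w -> vanish_on M X t w = 0.
Proof. by move=> Mw; rewrite /vanish_on indicE memNset ?mul0r //; apply. Qed.

Lemma measurable_vanish_on M X t : measurable M -> measurable_fun setT (X t) ->
  measurable_fun setT (vanish_on M X t).
Proof.
move=> mM mX; apply: measurable_funM => //.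
by apply: measurable_indic; exact: measurableC.
Qed.

Lemma clock_process_vanish_on M X : measurable M ->
  (forall t, 0 <= t -> measurable_fun setT (X t)) ->
  (forall w, ~ M w -> clock (X ^~ w)) -> clock_process (vanish_on M X).
Proof.
move=> mM mX cX; split => [t t0|w]; first by apply: measurable_vanish_on => //; exact: mX.
have [Mw|Mw] := pselect (M w).
  by apply: eq_clock clock_cst0 => t _; rewrite vanish_on0.
by apply: eq_clock (cX w Mw) => t _; rewrite vanish_onE.
Qed.

End null_sets.

Section subordinators.
Context d (T : measurableType d) (R : realType) (P : probability T R).
Variables (g : R) (D : R -> {RV P >-> R}).
Hypothesis hD : stable_subordinator g D.

Let mD t : measurable_fun setT (D t : T -> R). Proof. exact: measurable_funPT. Qed.

Lemma stable_subordinator_laplace s z : 0 <= s -> 0 <= z ->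
  (\int[P]_w (expR (- (z * D s w)))%:E = (expR (- (s * z `^ g)))%:E)%E.
Proof.
move=> s0 z0; case: hD => _ _ _ _ /(_ s z s0 z0) <-.
by rewrite unlock.
Qed.

(** Markov's inequality for [exp (- D k)], whose mean is [exp (- k)]. *)
Lemma stable_subordinator_le (k : nat) (M : R) :
  (P [set w | (D k%:R w <= M)%R] <= (expR (M - k%:R))%:E)%E.
Proof.
have mE : measurable [set w | D k%:R w <= M].
  by apply: measurable_fun_le_event => //; exact: measurable_cst.
have := @stable_subordinator_laplace k%:R 1 (ler0n _ _) ler01.
rewrite powR1 mulr1 => h.
have : ((expR (- M))%:E * P [set w | (D k%:R w <= M)%R] <= (expR (- k%:R))%:E)%E.
  rewrite -h -[X in P X]setIT -(@integral_indic _ _ _ P setT measurableT _ mE).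
  have mI : measurable_fun setT (fun w => (\1_[set w | D k%:R w <= M] w)%:E : \bar R).
    by apply/measurable_EFinP; exact: measurable_indic.
  rewrite -ge0_integralZl //.
    apply: ge0_le_integral => //.
    - exact: emeasurable_funM.
    - apply/measurable_EFinP; apply: measurableT_comp => //.
      apply: measurable_funN; exact: measurable_funM.
    - move=> w _; rewrite -EFinM lee_fin indicE.
      case: (boolP (w \in _)); rewrite ?mulr0 ?expR_ge0 // mulr1 mul1r inE /= => sX.
      by rewrite ler_expR lerN2.
have Pfin : P [set w | (D k%:R w <= M)%R] \is a fin_num by rewrite fin_num_measure.
rewrite -(fineK Pfin) -EFinM !lee_fin expRD (expRN M) => h'.
by rewrite -ler_pdivrMl ?expR_gt0.
Qed.

(** A path that stays below [n] does so at every integer [k], which has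
    probability at most [exp (n - k)]. *)
Lemma stable_subordinator_unbounded :
  {ae P, forall w, forall M : R, exists2 s, 0 <= s & M < D s w}.
Proof.
pose B (n : nat) := \bigcap_k [set w | D k%:R w <= n%:R].
have mle (k n : nat) : measurable [set w | D k%:R w <= n%:R].
  by apply: measurable_fun_le_event => //; exact: measurable_cst.
have mB n : measurable (B n) by apply: bigcap_measurable.
have B0 n : P (B n) = 0%E.
  apply/eqP; rewrite eq_le measure_ge0 andbT.
  apply/lee_addgt0Pr => e e0; rewrite add0e.
  have e1 : 1 < expR 1 :> R by rewrite expR_gt1.
  have [k hk] := exprn_unbounded (expR n%:R / e) e1.
  apply: (@le_trans _ _ (P [set w | D k%:R w <= n%:R])).
    by apply: le_measure; rewrite ?inE // => w /(_ k I).
  apply: le_trans (stable_subordinator_le k n%:R) _.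
  rewrite lee_fin expRB ler_pdivrMr ?expR_gt0 // mulrC -ler_pdivrMr //.
  by rewrite -expRM_natl mulr1 in hk; exact: ltW.
apply: (@negligibleS _ _ _ _ (\bigcup_n B n)); last first.
  by apply: negligible_bigcup => n; apply/(negligibleP _ (mB n)); exact: B0.
move=> w /= /existsNP [M hM].
have [n Mn] : exists n : nat, M <= n%:R.
  exists (Num.bound `|M|); apply: le_trans (ler_norm _) _.
  exact: ltW (archi_boundP (normr_ge0 _)).
exists n => // k _ /=; apply: le_trans Mn; rewrite leNgt; apply/negP => MD.
by apply: hM; exists k%:R.
Qed.

Definition inverse_path (E : R -> T -> R) (w : T) :=
  [/\ D 0 w = 0, nondecreasing_cadlag (fun t => D t w),
    (forall M : R, exists2 s, 0 <= s & M < D s w) &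
    forall t, 0 <= t -> E t w = first_passage (fun s => D s w) t].

Lemma ae_inverse_path (E : R -> T -> R) :
  {ae P, forall w, forall t, 0 <= t -> E t w = first_passage (fun s => D s w) t} ->
  {ae P, forall w, inverse_path E w}.
Proof.
move=> hE; case: hD => h0 _ _ hc _.
near=> w; split; near: w => //.
exact: stable_subordinator_unbounded.
Unshelve. all: by end_near. Qed.

Variables (E : R -> T -> R) (M : set T).
Hypotheses (mE : forall t, 0 <= t -> measurable_fun setT (E t)).
Hypotheses (mM : measurable M) (M0 : P M = 0%E).
Hypothesis hM : forall w, ~ M w -> inverse_path E w.

Lemma clock_process_inverse : clock_process (vanish_on M E).
Proof.
apply: clock_process_vanish_on => // w /hM [D0 [Dnd _] Du hE].
apply: (@eq_clock _ (first_passage (fun s => D s w))); first by move=> t /hE.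
exact: first_passage_clock.
Qed.

(** First passage times of a nondecreasing path satisfy the two-sided
    comparison required by [tail_exponent_comp]. *)
Lemma tail_exponent_inverse_comp S b : clock_process S -> tail_exponent P S b ->
  (forall s t, 0 <= t -> (tail P (fun t w => vanish_on M E (S t w) w) t s =
     \int[P]_w tail P (vanish_on M E) (S t w) s)%E) ->
  tail_exponent P (fun t w => vanish_on M E (S t w) w) (g * b).
Proof.
move=> cS hS ind.
have cE := clock_process_inverse.
pose D' := vanish_on M (fun s => D s : T -> R).
have mD' s : measurable_fun setT (D' s) by exact: measurable_vanish_on.
apply: (tail_exponent_comp (D := D') cE cS) => //.
- move=> s w s0; have [Mw|Mw] := pselect (M w); first by rewrite /D' vanish_on0.
  rewrite /D' vanish_onE //; have [D0 [Dnd _] _ _] := hM Mw.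
  by rewrite -D0; exact: Dnd.
- move=> s v s0 v0; apply: (le_probability_off_null mM M0).
  + by apply: measurable_fun_le_event => //; exact: measurable_cst.
  + exact: measurable_tail_event.
  + move=> w [/= + Mw]; rewrite /D' !vanish_onE //.
    have [D0 [Dnd _] Du hE] := hM Mw; rewrite hE //.
    exact: le_first_passage.
- move=> r s v r0 rs v0; apply: (le_probability_off_null mM M0).
  + exact: measurable_tail_event.
  + by apply: measurable_fun_le_event => //; exact: measurable_cst.
  + move=> w [/= + Mw]; rewrite /D' !vanish_onE //.
    have [D0 [Dnd _] Du hE] := hM Mw; rewrite hE //.
    exact: lt_first_passage.
- move=> s z s0 z0; rewrite -stable_subordinator_laplace ?(ltW z0) //.
  have mexp (Y : T -> R) : measurable_fun setT Y ->
      measurable_fun setT (fun w => (expR (- (z * Y w)))%:E).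
    move=> mY; apply/measurable_EFinP; apply: measurableT_comp => //.
    by apply: measurable_funN; exact: measurable_funM.
  apply: ge0_ae_eq_integral => //; [exact: mexp|exact: mexp|].
  exists M; split => // w /=; apply: contra_notP => Mw _.
  by rewrite /D' vanish_onE.
Qed.

End subordinators.

(** * Compositions of independent processes *)

Section independent_chain.
Context d (T : measurableType d) (R : realType) (P : probability T R).
Context (I : finType).
Implicit Types (X : R -> T -> R) (M : set T).

(** Independence of events at a single time of each process is all that
    compositions need, and it is insensitive to changes on null sets. *)
Definition marginal_events X : set (set T) :=
  [set A | exists2 t, 0 <= t & exists2 B : set R, measurable B & A = X t @^-1` B].

Definition chain (E : I -> R -> T -> R) (l : seq I) (t : R) (w : T) : R :=
  foldr (fun i s => E i s w) t l.

Lemma clock_process_id : clock_process (fun (t : R) (w : T) => t).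
Proof. by split => [t _|w]; [exact: measurable_cst|exact: clock_id]. Qed.

Lemma clock_process_chain (E : I -> R -> T -> R) (l : seq I) :
  (forall i, clock_process (E i)) -> clock_process (chain E l).
Proof.
move=> cE; elim: l => [|i l IH]; first exact: clock_process_id.
exact: (clock_process_comp (cE i) IH).
Qed.

Local Open Scope ereal_scope.

Variable E : I -> R -> T -> R.
Hypothesis cE : forall i, clock_process (E i).
Hypothesis indE : mutual_independence P (fun i => marginal_events (E i)).

Let measurable_marginal i A : marginal_events (E i) A -> measurable A.
Proof.
move=> [t t0 [B mB ->]]; rewrite -[X in measurable X]setTI.
exact: (cE i).1.
Qed.

Let capJ (J : {set I}) (A : I -> set T) := \bigcap_(i in [set i | i \in J]) A i.

Let measurable_capJ (J : {set I}) (A : I -> set T) :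
  (forall i, i \in J -> marginal_events (E i) (A i)) -> measurable (capJ J A).
Proof.
move=> hA; apply: fin_bigcap_measurable; first exact: finite_finset.
by move=> i /= iJ; exact: measurable_marginal (hA i iJ).
Qed.

(** The event [E i s \in B] joins the family [A], so that independence of the
    shorter chain can be applied to the enlarged set of indices. *)
Lemma chain_subst_independent (l : seq I) (i : I) (t : R) (B : set R) (J : {set I}) (A : I -> set T) :
  (forall (J' : {set I}) A', (forall j, j \in l -> j \notin J') ->
     (forall j, j \in J' -> marginal_events (E j) (A' j)) ->
     forall B', measurable B' -> right_stable B' ->
     P (capJ J' A' `&` [set w | B' (chain E l t w)]) =
     P (capJ J' A') * P [set w | B' (chain E l t w)]) ->
  i \notin J -> i \notin l -> (forall j, j \in l -> j \notin J) ->
  (forall j, j \in J -> marginal_events (E j) (A j)) ->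
  (0 <= t)%R -> measurable B -> right_stable B ->
  P (capJ J A `&` [set w | B (E i (chain E l t w) w)]) =
  P (capJ J A) * \int[P]_w P [set w' | B (E i (chain E l t w) w')].
Proof.
move=> IH iJ il lJ hA t0 mB rB.
have cS := clock_process_chain l cE.
have S0 w : (0 <= chain E l t w)%R by case: (cS.2 w) => + _ _; apply.
apply: (@clock_subst_independent _ _ _ P (capJ J A) (E i) (chain E l t) B) => //.
- exact: measurable_capJ.
- exact: cS.1.
move=> s k j s0.
pose A' o := if o == i then E i s @^-1` B else A o.
have A'J o : o \in J -> A' o = A o.
  by rewrite /A'; case: eqP => // ->; rewrite (negbTE iJ).
have A'i : A' i = E i s @^-1` B by rewrite /A' eqxx.
have hA' o : o \in (i |: J)%SET -> marginal_events (E o) (A' o).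
  rewrite in_setU1 => /orP[/eqP->|oJ]; last by rewrite A'J //; exact: hA.
  by rewrite A'i; exists s => //; exists B.
have capE : capJ (i |: J)%SET A' = capJ J A `&` [set w | B (E i s w)].
  apply/seteqP; split => w.
    move=> Aw; split => [a /= aJ|].
      by rewrite -A'J //; apply: Aw; rewrite /= in_setU1 aJ orbT.
    by have := Aw i; rewrite A'i; apply; rewrite /= in_setU1 eqxx.
  move=> [Aw Bw] o /=; rewrite in_setU1 => /orP[/eqP->|oJ]; first by rewrite A'i.
  by rewrite A'J //; exact: Aw.
have cellE : [set w | cell k (chain E l t w) = j] =
    [set w | `[(j%:R / k.+1%:R)%R, cell_end k j[%classic (chain E l t w)].
  by apply/seteqP; split => w /= /(cell_eq k j (S0 w)).
rewrite cellE -capE IH //.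
- congr (_ * _); rewrite /capJ indE // big_setU1 //= A'i muleC.
  rewrite (@indE J A) //; congr (_ * _).
  by apply: eq_bigr => o oJ; rewrite A'J.
- move=> o ol; rewrite in_setU1 negb_or lJ // andbT.
  by apply: contraNneq il => <-.
- exact: right_stable_itvco.
Qed.

(** Other processes are carried along as arbitrary events, because each step
    of the induction on the chain moves one process from the chain to those
    events. *)
Lemma chain_independent (l : seq I) (t : R) (J : {set I}) (A : I -> set T) (B : set R) :
  uniq l -> (forall j, j \in l -> j \notin J) ->
  (forall j, j \in J -> marginal_events (E j) (A j)) ->
  (0 <= t)%R -> measurable B -> right_stable B ->
  P (\bigcap_(j in [set j | j \in J]) A j `&` [set w | B (chain E l t w)]) =
  P (\bigcap_(j in [set j | j \in J]) A j) * P [set w | B (chain E l t w)].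
Proof.
move=> + + + t0; elim: l J A B => [|i l IH] J A B ul lJ hA mB rB.
  rewrite /=; have [Bt|Bt] := pselect (B t).
    rewrite (_ : [set _ : T | B t] = setT) ?setIT ?probability_setT ?mule1 //.
    by apply/seteqP; split.
  rewrite (_ : [set _ : T | B t] = set0) ?setI0 ?measure0 ?mule0 //.
  by apply/seteqP; split.
move: ul => /= /andP[il ul].
have IH' (J' : {set I}) A' : (forall j, j \in l -> j \notin J') ->
     (forall j, j \in J' -> marginal_events (E j) (A' j)) ->
     forall B', measurable B' -> right_stable B' ->
     P (capJ J' A' `&` [set w | B' (chain E l t w)]) =
     P (capJ J' A') * P [set w | B' (chain E l t w)].
  by move=> lJ' hA' B' mB' rB'; exact: IH.
rewrite (chain_subst_independent IH') //; last 2 first.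
- by apply: lJ; rewrite inE eqxx.
- by move=> j jl; apply: lJ; rewrite inE jl orbT.
congr (_ * _).
have := @chain_subst_independent l i t B finset.set0 (fun=> setT) IH'.
rewrite /capJ (_ : [set j | j \in _] = set0); last first.
  by apply/seteqP; split => // j /=; rewrite finset.in_set0.
rewrite bigcap_set0 setTI probability_setT mul1e => -> //.
- by rewrite finset.in_set0.
- by move=> j _; rewrite finset.in_set0.
- by move=> j; rewrite finset.in_set0.
Qed.

Lemma chain_law (l : seq I) (i : I) (t : R) (B : set R) : i \notin l -> uniq l ->
  (0 <= t)%R -> measurable B -> right_stable B ->
  P [set w | B (E i (chain E l t w) w)] =
  \int[P]_w P [set w' | B (E i (chain E l t w) w')].
Proof.
move=> il ul t0 mB rB.
have := @chain_subst_independent l i t B finset.set0 (fun=> setT).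
rewrite /capJ (_ : [set j | j \in _] = set0); last first.
  by apply/seteqP; split => // j /=; rewrite finset.in_set0.
rewrite bigcap_set0 setTI probability_setT mul1e => -> //.
- by move=> J' A' lJ' hA' B' mB' rB'; exact: chain_independent.
- by rewrite finset.in_set0.
- by move=> j _; rewrite finset.in_set0.
- by move=> j; rewrite finset.in_set0.
Qed.

End independent_chain.

(** * Mixed Poisson variables *)

Section mixed_poisson.
Context d (T : measurableType d) (R : realType) (P : probability T R).
Implicit Types (x y : R).

(** In contrast to [poisson_pmf], the weight of rate 0 is the point mass at 0.
    *)
Definition poisson_weight (y : R) (k : nat) : R := y ^+ k / k`!%:R * expR (- y).

Lemma poisson_weight_ge0 y k : 0 <= y -> 0 <= poisson_weight y k.
Proof. by move=> y0; rewrite !mulr_ge0 ?expR_ge0 ?exprn_ge0. Qed.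

Lemma measurable_poisson_weight k : measurable_fun setT (poisson_weight ^~ k).
Proof.
apply: measurable_funM.
  by apply: measurable_funM => //; exact: measurable_funX.
by apply: measurableT_comp => //; exact: measurable_funN.
Qed.

Lemma nneseries_expR y : (\sum_(0 <= k <oo) (y ^+ k / k`!%:R)%:E = (expR y)%:E)%E.
Proof.
rewrite expRE -EFin_lim; last first.
  rewrite /pseries/=; under eq_fun do rewrite mulrC.
  exact: is_cvg_series_exp_coeff.
apply/congr_lim/funext => n /=; rewrite /pseries /= /series /= -sumEFin //.
by under [in RHS]eq_bigr do rewrite mulrC.
Qed.

Lemma nneseries_poisson_weight x y : 0 <= y ->
  (\sum_(0 <= k <oo) ((expR (x * k%:R))%:E * (poisson_weight y k)%:E) =
   (expR (y * (expR x - 1)))%:E)%E.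
Proof.
move=> y0.
have -> : expR (y * (expR x - 1)) = expR (- y) * expR (y * expR x).
  by rewrite -expRD; congr expR; ring.
rewrite EFinM -(nneseries_expR (y * expR x)) -nneseriesZl; last first.
  by move=> k _; rewrite lee_fin divr_ge0 // exprn_ge0 // mulr_ge0 ?expR_ge0.
apply: eq_eseriesr => k _; rewrite -!EFinM; congr EFin.
by rewrite /poisson_weight exprMn (mulrC x) expRM_natl; ring.
Qed.

Variables (Z V : T -> R) (lambda : R).
Hypotheses (mZ : measurable_fun setT Z) (mV : measurable_fun setT V).
Hypotheses (Znat : forall w, exists k : nat, Z w = k%:R).
Hypotheses (V0 : forall w, 0 <= V w) (lambda0 : 0 < lambda).
Hypothesis ZV : forall k : nat,
  (P [set w | Z w = k%:R] = \int[P]_w (poisson_weight (lambda * V w) k)%:E)%E.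

Let lV0 w : 0 <= lambda * V w. Proof. by rewrite mulr_ge0 // ltW. Qed.

(** Summing [exp (x * k)] against Poisson weights of parameter [v] gives [exp
    (v * (exp x - 1))]. *)
Lemma mixed_poisson_exp_moment x :
  (\int[P]_w (expR (x * Z w))%:E =
   \int[P]_w (expR (lambda * (expR x - 1) * V w))%:E)%E.
Proof.
pose J w := cell 0 (Z w).
have Z0 w : 0 <= Z w by have [k ->] := Znat w.
have JE w : Z w = (J w)%:R.
  rewrite /J /cell; have [k ->] := Znat w.
  by rewrite mulr1 natrK.
have mJ : measurable_fun setT J by exact: measurable_cell.
transitivity (\int[P]_w (expR (x * (J w)%:R))%:E)%E.
  by apply: eq_integral => w _; rewrite -JE.
rewrite (integral_countable_subst P (g := fun k => (expR (x * k%:R))%:E)) //.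
transitivity (\sum_(0 <= k <oo)
    \int[P]_w ((expR (x * k%:R))%:E * (poisson_weight (lambda * V w) k)%:E))%E.
  have mw k : measurable_fun setT (fun w => (poisson_weight (lambda * V w) k)%:E).
    apply/measurable_EFinP; apply: (measurableT_comp (measurable_poisson_weight k)).
    exact: measurable_funM.
  apply: eq_eseriesr => k _; rewrite ge0_integralZl ?lee_fin ?expR_ge0 //; last first.
    by move=> w _; rewrite lee_fin poisson_weight_ge0.
  rewrite -ZV; congr (_ * P _)%E.
  by apply/seteqP; split => w /=; rewrite JE; [move=> ->|move/eqP; rewrite eqr_nat => /eqP].
rewrite -integral_nneseries //.
- apply: eq_integral => w _; rewrite nneseries_poisson_weight //.
  by congr (expR _)%:E; ring.
- move=> k; apply: emeasurable_funM => //.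
  apply/measurable_EFinP; apply: (measurableT_comp (measurable_poisson_weight k)).
  exact: measurable_funM.
- by move=> k w _; rewrite mule_ge0 ?lee_fin ?expR_ge0 ?poisson_weight_ge0.
Qed.

(** [exp (- lambda * V)] is at least [exp (- lambda * s)] on [V < s], an event
    of positive probability. *)
Lemma mixed_poisson_null_gt0 s : (P [set w | (s <= V w)%R] < 1)%E ->
  (0 < P [set w | Z w = 0%R])%E.
Proof.
move=> Vs.
have := ZV 0; rewrite (_ : [set w | Z w = 0%:R] = [set w | Z w = 0]) // => ->.
have mE : measurable [set w | s <= V w].
  by apply: measurable_fun_le_event => //; exact: measurable_cst.
have mEC := measurableC mE.
apply: (@lt_le_trans _ _ ((expR (- (lambda * s)))%:E * P (~` [set w | (s <= V w)%R]))%E).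
  rewrite mule_gt0 ?lte_fin ?expR_gt0 //.
  by rewrite probability_setC // sube_gt0.
have mI : measurable_fun setT (fun w => (\1_(~` [set w | s <= V w]) w)%:E : \bar R).
  by apply/measurable_EFinP; exact: measurable_indic.
rewrite -[X in P X]setIT -(@integral_indic _ _ _ P setT measurableT _ mEC).
rewrite -ge0_integralZl //.
apply: ge0_le_integral => //.
- exact: emeasurable_funM.
- apply/measurable_EFinP; apply: (measurableT_comp (measurable_poisson_weight 0)).
  exact: measurable_funM.
- move=> w _; rewrite /poisson_weight expr0 fact0 divr1 mul1r -EFinM lee_fin indicE.
  case: (boolP (w \in _)); rewrite ?mulr0 ?expR_ge0 // mulr1 inE /= => /negP.
  by rewrite -ltNge => /ltW sV; rewrite ler_expR lerN2 ler_pM2l.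
Qed.

End mixed_poisson.

(** * Sums of independent counts *)

Section independent_counts.
Context d (T : measurableType d) (R : realType) (Q : probability T R).
Context (I : finType) (K : I -> T -> nat).
Hypothesis mK : forall i, measurable_fun setT (K i).
Hypothesis indK : forall (J : {set I}) (k : I -> nat),
  Q (\bigcap_(i in [set i | i \in J]) [set w | K i w = k i]) =
  (\prod_(i in J) Q [set w | K i w = k i])%E.

Let level (J : {set I}) (k : I -> nat) :=
  \bigcap_(i in [set i | i \in J]) [set w | K i w = k i].

Let measurable_level J k : measurable (level J k).
Proof.
apply: fin_bigcap_measurable; first exact: finite_finset.
by move=> i _; exact: measurable_preimage_nat.
Qed.

Local Open Scope ereal_scope.

Let expsum (x : R) (l : seq I) (w : T) : R := expR (x * \sum_(i <- l) (K i w)%:R).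

Let measurable_expsum x l : measurable_fun setT (fun w => (expsum x l w)%:E).
Proof.
apply/measurable_EFinP; apply: measurableT_comp => //.
apply: measurable_funM => //.
have -> : (fun w => \sum_(i <- l) (K i w)%:R : R)%R =
    (fun w => \sum_(i <- l) ((fun n : nat => n%:R : R) \o K i) w)%R by [].
apply: measurable_sum => i.
exact: (measurable_fun_countable_subst (F := fun j => cst (j%:R : R)) (mK i)).
Qed.

(** Splitting according to the value of one count moves its index from the
    list [l] to the set [J], which is why the events indexed by [J] are part
    of the statement. *)
Lemma independent_counts_exp_moment (x : R) (l : seq I) (J : {set I}) (k : I -> nat) :
  uniq l -> (forall j, j \in l -> j \notin J) ->
  \int[Q]_(w in \bigcap_(i in [set i | i \in J]) [set w | K i w = k i])
    (expR (x * \sum_(i <- l) (K i w)%:R))%:E =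
  \prod_(i in J) Q [set w | K i w = k i] *
  \prod_(i <- l) \int[Q]_w (expR (x * (K i w)%:R))%:E.
Proof.
elim: l J k => [|i l IH] J k.
  move=> _ _; rewrite big_nil mule1 -indK.
  rewrite (eq_integral (cst 1)); last by move=> w _; rewrite big_nil mulr0 expR0.
  by rewrite integral_cst ?mul1e //; exact: measurable_level.
move=> /= /andP[il ul] lJ.
have iJ : i \notin J by apply: lJ; rewrite inE eqxx.
pose k' b j := if j == i then b else k j.
have k'J b j : j \in J -> k' b j = k j.
  by rewrite /k'; case: eqP => // ->; rewrite (negbTE iJ).
have levelE b : level (i |: J)%SET (k' b) = level J k `&` [set w | K i w = b].
  apply/seteqP; split => w.
    move=> Aw; split => [j /= jJ|].
      by rewrite -(k'J b j) //; apply: Aw; rewrite /= in_setU1 jJ orbT.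
    by have /= := Aw i; rewrite /k' eqxx; apply; rewrite in_setU1 eqxx.
  move=> [Aw Bw] j /=; rewrite in_setU1 => /orP[/eqP->|jJ]; first by rewrite /k' eqxx.
  by rewrite k'J //; exact: Aw.
rewrite big_cons muleA.
transitivity (\sum_(0 <= b <oo)
    (expR (x * b%:R))%:E * \int[Q]_(w in level (i |: J)%SET (k' b)) (expsum x l w)%:E).
  have E : level J k = \bigcup_b level (i |: J)%SET (k' b).
    apply/seteqP; split => w; first by exists (K i w) => //; rewrite levelE.
    by move=> [b _]; rewrite levelE => -[].
  rewrite -/(level J k) E ge0_integral_bigcup //.
  - apply: eq_eseriesr => b _; rewrite -ge0_integralZl //; last 2 first.
    + exact: (measurable_funTS (measurable_expsum x l)).
    + by move=> w _; rewrite lee_fin expR_ge0.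
    apply: eq_integral => w; rewrite inE levelE => -[_ /= Kb].
    by rewrite big_cons mulrDr expRD EFinM Kb.
  - by apply: measurable_funTS; exact: (@measurable_expsum x (i :: l)).
  - move=> b b' _ _ [w []]; rewrite !levelE => -[_ /= <-] [_ /= <-//].
have IHb b : \int[Q]_(w in level (i |: J)%SET (k' b)) (expsum x l w)%:E =
   \prod_(j in J) Q [set w | K j w = k j] * Q [set w | K i w = b] *
   \prod_(j <- l) \int[Q]_w (expR (x * (K j w)%:R))%:E.
  rewrite IH //; last first.
    move=> j jl; rewrite in_setU1 negb_or lJ ?inE ?jl ?orbT // andbT.
    by apply: contraNneq il => <-.
  rewrite big_setU1 //= /k' eqxx; congr (_ * _); rewrite muleC; congr (_ * _).
  by apply: eq_bigr => j jJ; case: eqP jJ => // ->; rewrite (negbTE iJ).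
under eq_eseriesr do rewrite IHb.
set p := \prod_(j in J) _; set q := \prod_(j <- l) _.
have p0 : 0 <= p by rewrite /p -indK.
have pfin : p \is a fin_num by rewrite /p -indK fin_num_measure //; exact: measurable_level.
have q0 : 0 <= q.
  rewrite /q; elim: (l) => [|j l' IHl]; first by rewrite big_nil.
  by rewrite big_cons mule_ge0 // integral_ge0.
rewrite -muleA (muleC _ q) muleA.
have pq0 : 0 <= p * q by exact: mule_ge0.
rewrite -ge0_integralZl //; last first.
  by apply: (measurable_fun_countable_subst
    (F := fun j => cst (expR (x * j%:R))%:E)) => //.
rewrite (integral_countable_subst Q (g := fun b => p * q * (expR (x * b%:R))%:E)) //.
  apply: eq_eseriesr => b _.
  rewrite (muleAC p) -[RHS]muleA [RHS]muleC [RHS]muleAC.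
  by rewrite -!muleA; congr (_ * _).
by move=> b; rewrite mule_ge0.
Qed.

End independent_counts.

(** * From roots to logarithms *)

Section logarithmic_limit.
Context {R : realType}.
Implicit Types (a b c e s u : R).

Lemma expR_le_quadratic u : u <= 2^-1 -> expR u <= 1 + u + 2 * u ^+ 2.
Proof.
move=> u2; have h := expR_ge1Dx (- u).
have e0 := expR_gt0 u.
have : expR (- u) * expR u = 1 by rewrite -expRD addNr expR0.
move: h; set v := expR (- u) => h uv.
have : (1 - u) * expR u <= v * expR u by rewrite ler_pM2r.
rewrite uv.
have u1 : 0 < 1 - u by lra.
have : 1 <= (1 - u) * (1 + u + 2 * u ^+ 2).
  have -> : (1 - u) * (1 + u + 2 * u ^+ 2) = 1 + u ^+ 2 * (1 - 2 * u) by ring.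
  by rewrite lerDl mulr_ge0 ?sqr_ge0 //; lra.
move=> h1 h2; rewrite -(ler_pM2l u1); lra.
Qed.

Lemma root_expR_ln a g (m : nat) : (0 < m)%N -> 0 < a -> a ^+ m = g ->
  a = expR (ln g / m%:R).
Proof.
move=> m0 a0 <-; rewrite lnXn // -[ln a *+ m]mulr_natr mulfK ?pnatr_eq0 -?lt0n //.
by rewrite lnK // posrE.
Qed.

(** Multiplied by [m], each difference of exponentials tends to the difference
    of the exponents; the quadratic bound on [expR] makes the error of order
    [1 / m]. *)
Lemma root_inequality_log a b c e s : 0 <= s ->
  (forall m : nat, (0 < m)%N ->
    2 * s * (expR (a / m%:R) - expR (c / m%:R)) <=
    s ^+ 2 * (expR (b / m%:R) - expR (c / m%:R)) +
    (expR (e / m%:R) - expR (c / m%:R))) ->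
  2 * s * (a - c) <= s ^+ 2 * (b - c) + (e - c).
Proof.
move=> s0 H; rewrite leNgt; apply/negP => gap.
pose C := 4 * s * c ^+ 2 + 2 * s ^+ 2 * b ^+ 2 + 2 * e ^+ 2.
pose g := 2 * s * (a - c) - (s ^+ 2 * (b - c) + (e - c)).
have g0 : 0 < g by rewrite /g; lra.
pose B := 2 * (`|b| + `|c| + `|e|) + C / g + 1.
have C0 : 0 <= C.
  have sc := mulr_ge0 s0 (sqr_ge0 c).
  have sb := mulr_ge0 (sqr_ge0 s) (sqr_ge0 b).
  have ee := sqr_ge0 e.
  by rewrite /C; lra.
have Cg : 0 <= C / g by rewrite divr_ge0 // ltW.
have nb := normr_ge0 b; have nc := normr_ge0 c; have ne := normr_ge0 e.
have B1 : 1 <= B by rewrite /B; lra.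
have B0 : 0 <= B by lra.
pose m := Num.bound B.
have mB : B < m%:R by exact: archi_boundP.
have m0 : 0 < m%:R :> R by lra.
have := H m; rewrite -(ltr0n R) => /(_ m0).
pose t : R := m%:R^-1; rewrite -/t.
have t0 : 0 < t by rewrite invr_gt0.
have mt : m%:R * t = 1 by rewrite mulfV ?gt_eqF.
have small u : `|u| <= `|b| + `|c| + `|e| -> u * t <= 2^-1.
  move=> hu; rewrite -(ler_pM2l m0) mulrCA mt mulr1.
  have := ler_norm u; rewrite /B in mB; lra.
have ha : 1 + a * t <= expR (a * t) by exact: expR_ge1Dx.
have hc : 1 + c * t <= expR (c * t) by exact: expR_ge1Dx.
have hb' := expR_le_quadratic (small b ltac:(lra)).
have hc' := expR_le_quadratic (small c ltac:(lra)).
have he' := expR_le_quadratic (small e ltac:(lra)).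
have s20 : 0 <= s ^+ 2 by exact: sqr_ge0.
have k1 : 2 * s * (a * t - c * t - 2 * (c * t) ^+ 2) <=
    2 * s * (expR (a * t) - expR (c * t)).
  by apply: ler_wpM2l; [rewrite mulr_ge0|lra].
have k2 : s ^+ 2 * (expR (b * t) - expR (c * t)) <=
    s ^+ 2 * (b * t + 2 * (b * t) ^+ 2 - c * t).
  by apply: ler_wpM2l => //; lra.
move=> H'.
have : t * g <= t * (C * t).
  have -> : t * g = 2 * s * (a * t - c * t) - (s ^+ 2 * (b * t - c * t) + (e * t - c * t)).
    by rewrite /g; ring.
  have -> : t * (C * t) = 2 * s * (2 * (c * t) ^+ 2) + s ^+ 2 * (2 * (b * t) ^+ 2) +
      2 * (e * t) ^+ 2 by rewrite /C; ring.
  by clear -k1 k2 H' he' hc; move: k1 k2 H' he' hc;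
    move: (expR (a * t)) (expR (b * t)) (expR (c * t)) (expR (e * t));
    move=> *; lra.
rewrite ler_pM2l // => gC.
have : m%:R * g <= C by rewrite -(ler_pM2r t0) mulrAC mt mul1r.
rewrite -ler_pdivlMr //.
by rewrite /B in mB; have := addr_ge0 (addr_ge0 nb nc) ne; lra.
Qed.

End logarithmic_limit.

Section divisible_laws.
Context {R : realType}.
Implicit Types (mu : probability R R).

Definition naturals : set R := range (fun k : nat => k%:R).

Lemma measurable_naturals : measurable naturals.
Proof.
rewrite (_ : naturals = \bigcup_k [set k%:R]).
  by apply: bigcup_measurable => k _; exact: measurable_set1.
by apply/seteqP; split => [x [k _ <-]|x [k _ ->]]; exists k.
Qed.

Lemma prod_EFin (I : finType) (J : {set I}) (f : I -> R) :
  (\prod_(i in J) (f i)%:E)%E = (\prod_(i in J) f i)%:E.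
Proof. by rewrite (big_morph EFin (@EFinM R) erefl). Qed.

Lemma prod_cst_ereal (I : Type) (l : seq I) (r : R) :
  (\prod_(i <- l) r%:E)%E = (r ^+ size l)%:E.
Proof.
by elim: l => [|i l IH]; rewrite ?big_nil // big_cons IH -EFinM -exprS.
Qed.

Lemma prod_cst_infty (I : Type) (l : seq I) : (0 < size l)%N ->
  (\prod_(i <- l) (+oo : \bar R))%E = +oo%E.
Proof.
case: l => // i l _; elim: l i => [|j l IH] i; first by rewrite big_seq1.
by rewrite big_cons IH mulyy.
Qed.

End divisible_laws.

(** * Summands of a divisible law on the naturals *)

Section divisible_component.
Context {R : realType} (mu : probability R R).
Context d (T : measurableType d) (Q : probability T R) (m : nat).
Variable Y : 'I_m -> {RV Q >-> R}.
Hypothesis m0 : (0 < m)%N.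
Hypothesis indY : independent_RVs Q Y.
Hypothesis idY : forall i j (A : set R), measurable A ->
  distribution Q (Y i) A = distribution Q (Y j) A.
Hypothesis sumY : forall A : set R, measurable A ->
  Q ((fun w => \sum_(i < m) Y i w) @^-1` A) = mu A.
Hypothesis mu_nat : mu (~` naturals) = 0%E.
Variables (p0 : R) (G : R -> R).
Hypotheses (p0_gt0 : 0 < p0) (mu0 : mu [set 0] = p0%:E).
Hypothesis GE : forall x, (\int[mu]_y (expR (x * y))%:E = (G x)%:E)%E.

Let i0 := Ordinal m0.
Let law (A : set R) : R := fine (Q (Y i0 @^-1` A)).

Let mY i (A : set R) : measurable A -> measurable (Y i @^-1` A).
Proof. by move=> mA; rewrite -[X in measurable X]setTI; exact: measurable_funPT. Qed.

Let lawE i (A : set R) : measurable A -> Q (Y i @^-1` A) = (law A)%:E.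
Proof.
move=> mA; rewrite /law fineK ?fin_num_measure //; last exact: mY.
exact: idY.
Qed.

Let law_ge0 A : 0 <= law A. Proof. exact: fine_ge0. Qed.

Let product_rule (J : {set 'I_m}) (A : 'I_m -> set R) :
  (forall i, measurable (A i)) ->
  Q (\bigcap_(i in [set i | i \in J]) (Y i @^-1` A i)) = (\prod_(i in J) law (A i))%:E.
Proof.
move=> mA; rewrite (@indY J (fun i => Y i @^-1` A i)).
  by rewrite -prod_EFin; apply: eq_bigr => i _; exact: lawE.
by move=> i _; exists (A i) => //; rewrite setTI.
Qed.

Let mcap (A : 'I_m -> set R) (J : {set 'I_m}) : (forall i, measurable (A i)) ->
  measurable (\bigcap_(i in [set i | i \in J]) (Y i @^-1` A i)).
Proof.
move=> mA; apply: fin_bigcap_measurable; first exact: finite_finset.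
by move=> i _; exact: mY.
Qed.

Let measurable_sumY : measurable_fun setT (fun w => \sum_(i < m) Y i w).
Proof. by apply: measurable_sum => i; exact: measurable_funPT. Qed.

Let cap_le_sum (A : 'I_m -> set R) (B : set R) :
  (forall i, measurable (A i)) -> measurable B ->
  (forall w, (forall i, A i (Y i w)) -> B (\sum_(i < m) Y i w)) ->
  ((\prod_i law (A i))%:E <= mu B)%E.
Proof.
move=> mA mB AB; rewrite -sumY //.
have -> : (\prod_i law (A i))%:E =
    Q (\bigcap_(i in [set i | i \in [set: 'I_m]%SET]) (Y i @^-1` A i)).
  rewrite product_rule //; congr EFin; apply: eq_bigl => i.
  by rewrite finset.in_setT.
apply: le_measure; rewrite ?inE.
- exact: mcap.
- by rewrite -[X in measurable X]setTI; exact: measurable_sumY.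
- by move=> w Aw; apply: AB => i; apply: Aw; rewrite /= finset.in_setT.
Qed.

Let neg : set R := `]-oo, 0[%classic.
Let mneg : measurable neg. Proof. exact: measurable_itv. Qed.
Let negE x : neg x <-> x < 0. Proof. by rewrite /neg /= in_itv. Qed.

(** If every summand is negative, so is the sum. *)
Let law_neg : law neg = 0.
Proof.
have : ((\prod_(i < m) law neg)%:E <= mu neg)%E.
  apply: (cap_le_sum (A := fun=> neg)) => // w hw.
  apply/negE; apply: (@lt_le_trans _ _ (\sum_(i < m) 0)).
    apply: ltr_sum; first by apply/hasP; exists i0; rewrite ?mem_index_enum.
    by move=> i _; apply/negE; exact: hw.
  by rewrite big1.
have -> : mu neg = 0%E.
  apply: (@subset_measure0 _ _ _ mu _ (~` naturals)) => //.
    exact: measurableC measurable_naturals.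
  by move=> x /negE x0 [k _ kx]; move: x0; rewrite -kx ltrn0.
rewrite lee_fin prodr_const card_ord => h.
apply/eqP; move: h; rewrite le_eqVlt => /orP[|]; first by rewrite expf_eq0 => /andP[].
by rewrite ltNge exprn_ge0.
Qed.

Let law_atom : law [set 0] ^+ m = p0.
Proof.
apply/EFin_inj; rewrite -mu0 -sumY; last exact: measurable_set1.
have -> : (law [set 0] ^+ m)%:E = Q (\bigcap_(i in [set i | i \in [set: 'I_m]%SET])
    (Y i @^-1` [set 0])).
  rewrite (@product_rule _ (fun=> [set 0])) //.
  by rewrite prodr_const cardsT card_ord.
pose M := \bigcup_(i in [set: 'I_m]) (Y i @^-1` neg).
have [mM QM] : measurable M /\ Q M = 0%E.
  by apply: probability_bigcup0 => i; [exact: mY|rewrite lawE // law_neg].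
apply: (eq_probability_off_null mM QM).
- exact: (mcap (A := fun=> [set 0])).
- by rewrite -[X in measurable X]setTI; exact: measurable_sumY.
- move=> w Mw; split => [h|/= /eqP].
    by rewrite /= big1 // => i _; apply: h; rewrite /= finset.in_setT.
  rewrite psumr_eq0 => [/allP h i _ /=|i _].
    by apply/eqP; apply: h; rewrite mem_index_enum.
  by rewrite leNgt; apply/negP => Yi; apply: Mw; exists i => //; exact/negE.
Qed.

Let law_atom_gt0 : 0 < law [set 0].
Proof.
rewrite lt_neqAle law_ge0 andbT; apply/eqP => h.
by move: p0_gt0; rewrite -law_atom -h expr0n eqn0Ngt m0 ltxx.
Qed.

(** With positive probability all the other summands are 0, and then the sum is
    the remaining summand. *)
Let law_nonnat : law (~` naturals) = 0.
Proof.
have mC : measurable (~` naturals : set R) by exact: measurableC measurable_naturals.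
have : ((\prod_(i < m) law (if i == i0 then ~` naturals else [set 0]))%:E
    <= mu (~` naturals))%E.
  apply: (cap_le_sum (A := fun i => if i == i0 then ~` naturals else [set 0])) => //.
    by move=> i; case: ifP.
  move=> w hw; have -> : \sum_(i < m) Y i w = Y i0 w.
    rewrite (bigD1 i0) //= big1 ?addr0 // => i ii0.
    by have := hw i; rewrite (negbTE ii0).
  by have /= := hw i0; rewrite ?eqxx.
rewrite mu_nat lee_fin (bigD1 i0) //= ?eqxx.
have rest : 0 < \prod_(i < m | i != i0) law (if i == i0 then ~` naturals else [set 0]).
  by apply: prodr_gt0 => i ii0; rewrite (negbTE ii0).
by rewrite pmulr_lle0 // => h; apply/eqP; rewrite eq_le h law_ge0.
Qed.

Let M := \bigcup_(i in [set: 'I_m]) (Y i @^-1` (~` naturals)).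

Let nullM : measurable M /\ Q M = 0%E.
Proof.
have mC : measurable (~` naturals : set R) by exact: measurableC measurable_naturals.
by apply: probability_bigcup0 => i; [exact: mY|rewrite lawE // law_nonnat].
Qed.

Let measurable_M : measurable M := nullM.1.
Let M0 : Q M = 0%E := nullM.2.

(** The counts agree with the summands off the null set [M], on which a summand
    may be negative. *)
Let K (i : 'I_m) (w : T) : nat := cell 0 (Num.max 0 (Y i w)).

Let mK i : measurable_fun setT (K i).
Proof.
apply: measurable_cell => [|w]; last by rewrite le_max lexx.
by apply: measurable_maxr.
Qed.

Let KE i w : ~ M w -> Y i w = (K i w)%:R.
Proof.
move=> Mw; have : naturals (Y i w) by apply: contrapT => h; apply: Mw; exists i.
by move=> [k _ kE]; rewrite /K /cell -kE (max_r (ler0n R k)) mulr1 natrK.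
Qed.

Let K_eq i w k : ~ M w -> K i w = k <-> Y i w = k%:R.
Proof.
move=> Mw; rewrite (KE i Mw); split => [->//|/eqP].
by rewrite eqr_nat => /eqP.
Qed.

Let K_law i k : Q [set w | K i w = k] = (law [set k%:R])%:E.
Proof.
rewrite -(lawE i) //; apply: (eq_probability_off_null measurable_M M0).
- exact: measurable_preimage_nat.
- exact: mY.
- by move=> w Mw; exact: K_eq.
Qed.

Let indK (J : {set 'I_m}) (k : 'I_m -> nat) :
  Q (\bigcap_(i in [set i | i \in J]) [set w | K i w = k i]) =
  (\prod_(i in J) Q [set w | K i w = k i])%E.
Proof.
transitivity (Q (\bigcap_(i in [set i | i \in J]) (Y i @^-1` [set (k i)%:R]))).
  apply: (eq_probability_off_null measurable_M M0).
  - apply: fin_bigcap_measurable; first exact: finite_finset.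
    by move=> i _; exact: measurable_preimage_nat.
  - exact: mcap.
  - by move=> w Mw; split => h i iJ; apply/(K_eq _ _ Mw); exact: h.
rewrite product_rule // -prod_EFin; apply: eq_bigr => i _.
by rewrite K_law.
Qed.

Local Open Scope ereal_scope.

Let phi (x : R) : \bar R := \int[Q]_w (expR (x * (K i0 w)%:R))%:E.

Let phiE i x : \int[Q]_w (expR (x * (K i w)%:R))%:E = phi x.
Proof.
rewrite /phi !(integral_countable_subst Q (g := fun k => (expR (x * k%:R))%:E)) //.
by apply: eq_eseriesr => k _; rewrite !K_law.
Qed.

Let sum_exp_moment x :
  \int[mu]_y (expR (x * y))%:E = \int[Q]_w (expR (x * \sum_(i < m) Y i w))%:E.
Proof.
have mf : measurable_fun setT (fun y : R => (expR (x * y))%:E : \bar R).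
  by apply/measurable_EFinP; apply: measurableT_comp => //; exact: measurable_funM.
transitivity (\int[pushforward Q (fun w => \sum_(i < m) Y i w)%R]_y (expR (x * y))%:E).
  apply: eq_measure_integral => A mA _.
  exact: (esym (sumY mA)).
rewrite ge0_integral_pushforward //.
Qed.

Let mu_exp_moment x : (G x)%:E = \prod_(i < m) phi x.
Proof.
rewrite -GE sum_exp_moment.
have := @independent_counts_exp_moment _ _ _ Q _ K mK indK x
  (index_enum 'I_m) finset.set0 (fun=> 0%N) (index_enum_uniq _).
rewrite (_ : [set j | j \in _] = set0); last first.
  by apply/seteqP; split => // j /=; rewrite finset.in_set0.
rewrite bigcap_set0 big_set0 mul1e => H.
have {}H := H (fun j _ => negbT (finset.in_set0 j)).
have -> : \prod_(i < m) phi x =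
    \prod_(i < m) \int[Q]_w (expR (x * (K i w)%:R))%:E.
  by apply: eq_bigr => i _; rewrite phiE.
rewrite -H.
have msum (X : 'I_m -> T -> R) : (forall i, measurable_fun setT (X i)) ->
    measurable_fun setT (fun w => (expR (x * \sum_(i < m) X i w))%:E : \bar R).
  move=> mX; apply/measurable_EFinP; apply: measurableT_comp => //.
  by apply: measurable_funM => //; exact: measurable_sum.
apply: ge0_ae_eq_integral => //.
- by apply: msum => i; exact: measurable_funPT.
- apply: (msum (fun i w => (K i w)%:R)) => i.
  exact: (measurable_fun_countable_subst (F := fun j => cst (j%:R : R)) (mK i)).
- exists M; split; [exact: measurable_M|exact: M0|].
  move=> w /=; apply: contra_notP => Mw _.
  by congr (expR (_ * _))%:E; apply: eq_bigr => i _; rewrite KE.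
Qed.

Let phi_ge0 x : 0 <= phi x. Proof. by apply: integral_ge0. Qed.

Let phi_fin x : phi x \is a fin_num.
Proof.
rewrite ge0_fin_numE ?phi_ge0 // ltey; apply/eqP => phiy.
have := mu_exp_moment x; rewrite phiy prod_cst_infty //.
by rewrite /index_enum -enumT size_enum_ord.
Qed.

Let null (w : T) : R := \1_[set w | K i0 w = 0%N] w.

Let nullE w : null w = (K i0 w == 0%N)%:R.
Proof. by rewrite /null indicE; congr ((_ : bool)%:R); apply/idP/eqP; rewrite inE. Qed.

Let measurable_null : measurable_fun setT (fun w => (null w)%:E : \bar R).
Proof.
apply/measurable_EFinP; apply: measurable_indic.
exact: measurable_preimage_nat.
Qed.

Let integral_null : \int[Q]_w (null w)%:E = (law [set 0%R])%:E.
Proof.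
have mE : measurable [set w | K i0 w = 0%N] by exact: measurable_preimage_nat.
have := @integral_indic _ _ _ Q setT measurableT _ mE; rewrite setIT => ->.
exact: (K_law i0 0).
Qed.

Let measurable_exp (z : R) : measurable_fun setT (fun w => (expR (z * (K i0 w)%:R))%:E : \bar R).
Proof.
exact: (measurable_fun_countable_subst (F := fun j => cst (expR (z * j%:R))%:E) (mK i0)).
Qed.

Let phi_root x : fine (phi x) = expR (ln (G x) / m%:R).
Proof.
apply: root_expR_ln => //.
  apply: (lt_le_trans law_atom_gt0).
  rewrite -lee_fin (fineK (phi_fin x)) -integral_null; apply: ge0_le_integral => //.
    by move=> w _; rewrite lee_fin nullE.
  move=> w _; rewrite lee_fin nullE; case: eqP => [->|_].
    by rewrite mulr0 expR0.
  exact: expR_ge0.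
apply/EFin_inj; rewrite mu_exp_moment.
have -> : \prod_(i < m) phi x = \prod_(i < m) (fine (phi x))%:E.
  by apply: eq_bigr => i _; rewrite fineK.
by rewrite prod_cst_ereal /index_enum -enumT size_enum_ord.
Qed.

(** The [m]-th roots of [G x] and of [p0] are the exponential moment and the
    atom at 0 of one summand [K]. The inequality is the integral over [K != 0]
    of [2 * s * (u * v) <= s ^+ 2 * u ^+ 2 + v ^+ 2], with [u = exp (x * K /
    2)] and [v = exp (y * K / 2)]. *)
Lemma divisible_component_inequality x y s : (0 < s)%R ->
  (2 * s * (expR (ln (G ((x + y) / 2)) / m%:R) - expR (ln p0 / m%:R)) <=
    s ^+ 2 * (expR (ln (G x) / m%:R) - expR (ln p0 / m%:R)) +
    (expR (ln (G y) / m%:R) - expR (ln p0 / m%:R)))%R.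
Proof.
move=> s0; rewrite -!phi_root -(root_expR_ln m0 law_atom_gt0 law_atom).
set h := ((x + y) / 2)%R; set q := law _.
have s20 : (0 <= s ^+ 2)%R by exact: sqr_ge0.
have pull (c : R) (f : T -> R) : (0 <= c)%R -> (forall w, (0 <= f w)%R) ->
    measurable_fun setT (fun w => (f w)%:E : \bar R) ->
    measurable_fun setT (fun w => c%:E * (f w)%:E) /\
    c%:E * \int[Q]_w (f w)%:E = \int[Q]_w (c%:E * (f w)%:E).
  move=> c0 f0 mf; split; first exact: measurable_funeM.
  by rewrite ge0_integralZl // => w _; rewrite lee_fin.
have e0 (z : R) w : (0 <= expR (z * (K i0 w)%:R))%R by exact: expR_ge0.
have n0 w : (0 <= null w)%R by rewrite nullE.
have [m1 E1] := pull (2 * s)%R (fun w => expR (h * (K i0 w)%:R)) ltac:(lra) (e0 h) (measurable_exp h).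
have [m2 E2] := pull (s ^+ 2 + 1)%R null ltac:(lra) n0 measurable_null.
have [m3 E3] := pull (s ^+ 2)%R (fun w => expR (x * (K i0 w)%:R)) s20 (e0 x) (measurable_exp x).
have [m4 E4] := pull (2 * s)%R null ltac:(lra) n0 measurable_null.
have m34 := emeasurable_funD m3 (measurable_exp y).
have key : (2 * s)%:E * phi h + (s ^+ 2 + 1)%:E * q%:E <=
    (s ^+ 2)%:E * phi x + phi y + (2 * s)%:E * q%:E.
  rewrite -integral_null E1 E2 E3 E4 -ge0_integralD //; last 2 first.
  - by move=> w _; rewrite -EFinM lee_fin mulr_ge0 //; lra.
  - by move=> w _; rewrite -EFinM lee_fin mulr_ge0 //; lra.
  rewrite -ge0_integralD //; last first.
  - by move=> w _; rewrite -EFinM lee_fin mulr_ge0.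
  rewrite -ge0_integralD //; last 2 first.
  - by move=> w _; rewrite -EFinM -EFinD lee_fin addr_ge0 // mulr_ge0.
  - by move=> w _; rewrite -EFinM lee_fin mulr_ge0 //; lra.
  apply: ge0_le_integral => //.
  - by move=> w _; rewrite -!EFinM -EFinD lee_fin addr_ge0 // mulr_ge0 //; lra.
  - exact: emeasurable_funD.
  - exact: emeasurable_funD.
  move=> w _; rewrite -!EFinM -!EFinD lee_fin nullE.
  case: eqP => [->|_]; first by rewrite /= !mulr0 !expR0; lra.
  set k := (K i0 w)%:R; rewrite !mulr0 !addr0.
  have -> : (expR (x * k) = expR (x * k / 2) ^+ 2)%R.
    by rewrite expr2 -expRD; congr expR; field.
  have -> : (expR (y * k) = expR (y * k / 2) ^+ 2)%R.
    by rewrite expr2 -expRD; congr expR; field.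
  have -> : (expR (h * k) = expR (x * k / 2) * expR (y * k / 2))%R.
    by rewrite -expRD /h; congr expR; field.
  rewrite -subr_ge0; set u := expR _; set v := expR _.
  have -> : (s ^+ 2 * u ^+ 2 + v ^+ 2 - 2 * s * (u * v) = (s * u - v) ^+ 2)%R by ring.
  exact: sqr_ge0.
move: key; rewrite -(fineK (phi_fin h)) -(fineK (phi_fin x)) -(fineK (phi_fin y)).
by rewrite -!EFinM -!EFinD lee_fin; lra.
Qed.

End divisible_component.

(** * Growth of the logarithmic moments *)

Section moment_growth.
Context {R : realType}.

(** [L] plays the role of [y |-> log (E (exp (y * S)))] and [- c] that of [log
    P (Z = 0)]. The sequence to which [logconvex_growth_absurd] applies
    samples [L] at [y = lambda * (u - 1)] with [u = 2 ^+ k], that is, the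
    generating function at the integers [2 ^+ k]. *)
Lemma moment_growth_absurd (L : R -> R) (b t lambda c : R) :
  0 < b < 1 -> 0 < t -> 0 < lambda -> 0 <= c ->
  (forall y e, 0 < y -> 0 < e ->
     L y <= 1 + (y + e) `^ b^-1 * t + ln (1 + y / e)) ->
  (forall rho, 0 < rho < 1 -> exists y0, forall y, y0 <= y ->
     rho ^+ 2 * t * y `^ b^-1 - ln 2 <= L y) ->
  L 0 = 0 ->
  (forall k s, 0 < s ->
     2 * s * (L (lambda * (2 ^+ k.+1 - 1)) + c) <=
     s ^+ 2 * (L (lambda * (2 ^+ k - 1)) + c) + (L (lambda * (2 ^+ k.+2 - 1)) + c)) ->
  False.
Proof.
move=> /andP[b0 b1] t0 l0 c0 up low L0 conv.
pose p := b^-1.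
have p1 : 1 < p by rewrite /p invf_gt1.
pose q : R := 2 `^ p.
have two0 : 0 < 2 :> R by [].
have qk k : q ^+ k = (2 ^+ k) `^ p.
  by rewrite -powR_mulrn ?powR_ge0 // -powRrM mulrC powRrM powR_mulrn.
have q2 : 2 < q.
  rewrite /q -[ltLHS](powRr1 (ltW two0)) /powR !gt_eqF //.
  by rewrite ltr_expR ltr_pM2r // ln_gt0 // ltr1n.
pose a := t * lambda `^ p.
have a0 : 0 < a by rewrite mulr_gt0 // powR_gt0.
have tk1 k : 1 <= 2 ^+ k :> R by apply: exprn_ege1; rewrite ler1n.
have l2 : 0 < ln 2 :> R by rewrite ln_gt0 // ltr1n.
apply: (@logconvex_growth_absurd R (fun k => L (lambda * (2 ^+ k - 1)) + c)
  a q (1 + ln 2 + c) (ln 2) a0 q2 conv).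
- move=> rho /andP[rho0 rho1].
  (* Two factors sg come from the moment bound, the third one bounds
     (1 - 2 ^- k) `^ p from below for large k. *)
  pose sg := 1 - (1 - rho) / 4.
  have sg01 : 0 < sg < 1 by rewrite /sg; lra.
  have [sg0 sg1] := andP sg01.
  have sg3 : 0 < sg ^+ 3 - rho.
    have := @bernoulli_exprn R (- ((1 - rho) / 4)) 3 ltac:(lra).
    by rewrite -/sg; lra.
  have [y0 hy0] := low sg sg01.
  have sgb1 : sg `^ b < 1.
    have := @gt0_ltr_powR R b b0 sg 1; rewrite !nnegrE powR1; apply => //.
    exact: ltW.
  have [K1 hK1] := @exprn_beats_linear R lambda 2 (y0 + lambda) 0 l0 ltac:(lra).
  have [K2 hK2] := @exprn_beats_linear R (1 - sg `^ b) 2 1 0 ltac:(lra) ltac:(lra).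
  have [K3 hK3] := @exprn_beats_linear R ((sg ^+ 3 - rho) * a) q (ln 2) 0
    (mulr_gt0 sg3 a0) ltac:(lra).
  exists (maxn K1 (maxn K2 K3)) => k; rewrite !geq_max => /and3P[k1 k2 k3].
  have {}h1 := hK1 k k1; have {}h2 := hK2 k k2; have {}h3 := hK3 k k3.
  rewrite !mul0r !addr0 in h1 h2 h3.
  set X := 2 ^+ k in h1 h2 *.
  have X1 : 1 <= X by exact: tk1.
  have := hy0 (lambda * (X - 1)) ltac:(lra).
  have -> : lambda * (X - 1) = lambda * X * (1 - X^-1) by field; lra.
  rewrite -/p powRM ?powRM; last 4 first.
  + by lra.
  + by lra.
  + by rewrite mulr_ge0 //; lra.
  + by rewrite subr_ge0 invf_le1 //; lra.
  rewrite -qk.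
  have sgX : sg <= (1 - X^-1) `^ p.
    have -> : sg = (sg `^ b) `^ p by rewrite -powRrM mulfV ?gt_eqF // powRr1 // ltW.
    apply: ge0_ler_powR; rewrite ?nnegrE ?powR_ge0 //; first lra.
      by rewrite subr_ge0 invf_le1 //; lra.
    have : X^-1 * 1 <= X^-1 * ((1 - sg `^ b) * X).
      by rewrite ler_pM2l ?invr_gt0 //; lra.
    have -> : X^-1 * ((1 - sg `^ b) * X) = 1 - sg `^ b by field; lra.
    by lra.
  have A0 : 0 <= sg ^+ 2 * (a * q ^+ k).
    by rewrite mulr_ge0 ?sqr_ge0 // mulr_ge0 ?(ltW a0) // exprn_ge0 //; lra.
  have := ler_wpM2l A0 sgX.
  have -> : sg ^+ 2 * t * (lambda `^ p * q ^+ k * (1 - X^-1) `^ p) =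
    sg ^+ 2 * (a * q ^+ k) * (1 - X^-1) `^ p by rewrite /a; ring.
  have -> : sg ^+ 2 * (a * q ^+ k) * sg = sg ^+ 3 * a * q ^+ k by ring.
  by lra.
- case=> [|k].
    rewrite !expr0 subrr mulr0 L0 add0r mulr0 addr0 mulr1.
    have : 0 <= a * (1 - 1 / 2) by rewrite mulr_ge0 //; lra.
    by lra.
  set X : R := 2 ^+ k.+1.
  have X2 : 2 <= X by rewrite /X exprS ler_peMr.
  have y0 : 0 < lambda * (X - 1) by rewrite mulr_gt0 //; lra.
  (* This e leads to the argument lambda * (2 ^+ k - 1/2), still below
     lambda * 2 ^+ k, at the cost of a logarithm linear in k. *)
  have e0 : 0 < lambda / 2 by rewrite divr_gt0.
  have := up _ _ y0 e0.
  have -> : 1 + lambda * (X - 1) / (lambda / 2) = 2 * X - 1 by field; lra.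
  have lnX : ln (2 * X - 1) <= ln 2 + ln 2 * k.+1%:R.
    apply: (@le_trans _ _ (ln (2 * X))).
      by rewrite ler_ln ?posrE //; lra.
    by rewrite lnM ?posrE //; [rewrite /X lnXn // mulr_natr|lra].
  have -> : lambda * (X - 1) + lambda / 2 = lambda * X * (1 - X^-1 / 2) by field; lra.
  have Xi : 0 < X^-1 <= 2^-1.
    by rewrite invr_gt0 lef_pV2 ?posrE //; lra.
  have [Xi0 Xi1] := andP Xi.
  rewrite -/p powRM ?powRM; last 4 first.
  + by lra.
  + by lra.
  + by rewrite mulr_ge0 //; lra.
  + by lra.
  rewrite -qk.
  have h : (1 - X^-1 / 2) `^ p <= 1 - X^-1 / 2.
    by apply: ge1r_powR; lra.
  have A0 : 0 <= a * q ^+ k.+1.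
    by rewrite mulr_ge0 ?(ltW a0) // exprn_ge0 //; lra.
  have := ler_wpM2l A0 h.
  have -> : lambda `^ p * q ^+ k.+1 * (1 - X^-1 / 2) `^ p * t =
    a * q ^+ k.+1 * (1 - X^-1 / 2) `^ p by rewrite /a; ring.
  rewrite exprVn -/X.
  by lra.
Qed.

End moment_growth.

(** * Infinite divisibility of a Poisson process at an independent time *)

Section infinitely_divisible_criterion.
Context {R : realType} (mu : probability R R) (p0 : R) (G : R -> R).

(** For each [m] the inequality holds between [m]-th roots; being linear in
    them for fixed [s], it survives the limit. Optimising over [s] gives
    log-convexity of [ln (G x) - ln p0]. *)
Lemma infinitely_divisible_log_moment :
  infinitely_divisible mu -> mu (~` naturals) = 0%E ->
  0 < p0 -> mu [set 0] = p0%:E ->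
  (forall x, (\int[mu]_y (expR (x * y))%:E = (G x)%:E)%E) ->
  forall x y s, 0 < s ->
    2 * s * (ln (G ((x + y) / 2)) - ln p0) <=
    s ^+ 2 * (ln (G x) - ln p0) + (ln (G y) - ln p0).
Proof.
move=> hdiv munat p00 mu0 GE x y s s0.
apply: root_inequality_log; first exact: ltW.
move=> m m0; have [d [T [Q [Y [indY idY sumY]]]]] := hdiv m m0.
exact: (divisible_component_inequality m0 indY idY sumY munat p00 mu0 GE).
Qed.

End infinitely_divisible_criterion.

Section subordinated_poisson.
Context d (T : measurableType d) (R : realType) (P : probability T R).

Lemma process_sigma_marginal d' (T' : measurableType d') (X : R -> T -> T')
    (t : R) (B : set T') : 0 <= t -> measurable B -> process_sigma X (X t @^-1` B).
Proof.
move=> t0 mB; apply: sub_sigma_algebra; exists t => //.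
by exists B => //; rewrite setTI.
Qed.

Lemma poisson_marginal (lambda : R) (N : R -> {RV P >-> nat}) v k :
  0 < lambda -> poisson_process lambda N -> 0 <= v ->
  P [set w | N v w = k] = (poisson_weight (lambda * v) k)%:E.
Proof.
move=> l0 [N0 _ _ Nlaw] v0.
have [M [mM M0 NM]] := N0.
have N0M w : ~ M w -> N 0 w = 0%N by move=> Mw; apply: contrapT => h; apply: Mw; exact: NM.
have mN t j : measurable [set w | N t w = j].
  by apply: measurable_preimage_nat; exact: measurable_funPT.
have [v_gt0|v_le0] := ltP 0 v.
  have := Nlaw 0 v k (lexx _) v_gt0.
  rewrite add0r /poisson_pmf mulr_gt0 // => <-.
  apply: (eq_probability_off_null mM M0) => //.
    rewrite (_ : [set w | N v w = (N 0%R w + k)%N] =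
        \bigcup_j ([set w | N 0 w = j] `&` [set w | N v w = (j + k)%N])).
      by apply: bigcup_measurable => j _; exact: measurableI.
    by apply/seteqP; split => [w h|w [j _ [/= <-]]//]; exists (N 0 w).
  by move=> w Mw /=; rewrite N0M.
have -> : v = 0 by apply/eqP; rewrite eq_le v_le0 v0.
rewrite mulr0 /poisson_weight oppr0 expR0 mulr1.
case: k => [|k].
  rewrite expr0 fact0 divr1 -(@probability_setT _ _ _ P).
  by apply: (eq_probability_off_null mM M0) => // w Mw /=; rewrite N0M.
rewrite expr0n /= mul0r; transitivity (P set0); last by rewrite measure0.
by apply: (eq_probability_off_null mM M0) => // w Mw /=; rewrite N0M.
Qed.

Lemma integral_one : (\int[P]_w (cst 1%E w) = 1)%E.
Proof. by rewrite integral_cst // mul1e; exact: probability_setT. Qed.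

Lemma exp_moment_fin (S : R -> T -> R) b t y : clock_process S ->
  tail_exponent P S b -> 0 < b -> 0 <= t ->
  (\int[P]_w (expR (y * S t w))%:E)%E \is a fin_num.
Proof.
move=> cS hS b0 t0.
have S0 w : 0 <= S t w by case: (cS.2 w) => + _ _; apply.
rewrite ge0_fin_numE; last by apply: integral_ge0.
have [y0|y0] := ltP 0 y.
  by apply: le_lt_trans (exp_moment_le cS hS b0 t0 y0 ltr01) _; rewrite ltry.
apply: (@le_lt_trans _ _ (\int[P]_w (cst 1%E w))%E).
  apply: ge0_le_integral => //.
    apply/measurable_EFinP; apply: measurableT_comp => //.
    by apply: measurable_funM => //; exact: cS.1.
  by move=> w _; rewrite lee_fin -expR0 ler_expR mulr_le0_ge0.
by rewrite integral_one ltry.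
Qed.

(** Any natural-valued [Z] that is Poisson of parameter [lambda * S t] given
    [S t] will do: [tail_exponent] alone controls the growth of the moments of
    [S t]. *)
Lemma poisson_subordination_not_divisible (Z : {RV P >-> R}) (S : R -> T -> R)
    (b t lambda : R) :
  clock_process S -> tail_exponent P S b -> 0 < b < 1 -> 0 < t -> 0 < lambda ->
  (forall w, exists k : nat, Z w = k%:R) ->
  (forall k : nat, P [set w | Z w = k%:R] =
     \int[P]_w (poisson_weight (lambda * S t w) k)%:E)%E ->
  ~ infinitely_divisible (distribution P Z).
Proof.
move=> cS hS /[dup] hb /andP[b0 b1] t0 l0 Znat Zlaw hdiv.
have S0 w : 0 <= S t w by case: (cS.2 w) => + _ _; apply; exact: ltW.
have mS : measurable_fun setT (S t) by apply: cS.1; exact: ltW.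
have mZ : measurable_fun setT (Z : T -> R) by exact: measurable_funPT.
pose E y := (\int[P]_w (expR (y * S t w))%:E)%E.
have Efin y : E y \is a fin_num by exact: (exp_moment_fin y cS hS b0 (ltW t0)).
pose L y := ln (fine (E y)).
have Elow rho : 0 < rho < 1 -> exists y0, forall y, y0 <= y ->
    2^-1 * expR (rho ^+ 2 * t * y `^ b^-1) <= fine (E y).
  move=> hr; have [y0 hy0] := exp_moment_ge cS hS t0 hr hb.
  by exists y0 => y /hy0; rewrite -lee_fin fineK.
have Epos y : 0 <= y -> 1 <= fine (E y).
  move=> y0; rewrite -lee_fin fineK //.
  apply: (@le_trans _ _ (\int[P]_w (cst 1%E w))%E).
    by rewrite integral_one.
  apply: ge0_le_integral => //.
    apply/measurable_EFinP; apply: measurableT_comp => //.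
    exact: measurable_funM.
  by move=> w _; rewrite lee_fin -expR0 ler_expR mulr_ge0.
pose G x := fine (E (lambda * (expR x - 1))).
have GE x : (\int[distribution P Z]_y (expR (x * y))%:E = (G x)%:E)%E.
  rewrite ge0_integral_distribution //; last first.
    by apply/measurable_EFinP; apply: measurableT_comp => //; exact: measurable_funM.
  rewrite /G fineK // /E -(mixed_poisson_exp_moment mZ mS Znat S0 l0 Zlaw).
  by [].
(* The Chernoff bound at rate 1 is exp (- 1) at the level t + 1. *)
have Ztail : (P [set w | (t + 1 <= S t w)%R] < 1)%E.
  have := tail_chernoff cS hS ltr01 (ltW t0) (_ : 0 <= t + 1).
  move=> /(_ ltac:(lra)) /le_lt_trans; apply.
  rewrite lte_fin powR1 mul1r mulr1 -[ltRHS]expR0 ltr_expR; lra.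
have m0 : measurable [set w | Z w = 0].
  by rewrite -[X in measurable X]setTI; exact: (mZ measurableT _ (measurable_set1 0)).
pose p0 := fine (P [set w | Z w = 0%R]).
have p0E : P [set w | Z w = 0%R] = p0%:E by rewrite /p0 fineK // fin_num_measure.
have p00 : 0 < p0.
  by rewrite -lte_fin -p0E; exact: (mixed_poisson_null_gt0 mS l0 Zlaw Ztail).
have p01 : p0 <= 1 by rewrite -lee_fin -p0E; exact: probability_le1.
have munat : distribution P Z (~` naturals) = 0%E.
  rewrite /distribution /pushforward (_ : _ @^-1` _ = set0) ?measure0 //.
  by apply/seteqP; split => // w /=; apply; have [k ->] := Znat w; exists k.
have key := infinitely_divisible_log_moment hdiv munat p00 p0E GE.
apply: (@moment_growth_absurd R L b t lambda (- ln p0) hb t0 l0).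
- by rewrite oppr_ge0 ln_le0.
- move=> y e y0 e0; have := exp_moment_le cS hS b0 (ltW t0) y0 e0.
  rewrite -/(E y) -(fineK (Efin y)) lee_fin => h.
  rewrite /L; apply: (@le_trans _ _ (ln (expR (1 + (y + e) `^ b^-1 * t) * (1 + y / e)))).
    rewrite ler_ln ?posrE //.
      by apply: lt_le_trans (Epos y (ltW y0)).
    by rewrite mulr_gt0 ?expR_gt0 // addr_gt0 // divr_gt0.
  rewrite lnM ?posrE ?expR_gt0 ?expRK //.
  by rewrite addr_gt0 // divr_gt0.
- move=> rho hr; have [y0 hy0] := Elow rho hr.
  exists y0 => y /hy0 h.
  rewrite /L; apply: (@le_trans _ _ (ln (2^-1 * expR (rho ^+ 2 * t * y `^ b^-1)))).
    rewrite lnM ?posrE ?expR_gt0 ?invr_gt0 // expRK lnV ?posrE //.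
    by rewrite addrC.
  rewrite ler_ln ?posrE //; first by rewrite mulr_gt0 ?expR_gt0 ?invr_gt0.
  by apply: lt_le_trans h; rewrite mulr_gt0 ?expR_gt0 ?invr_gt0.
- rewrite /L /E (_ : (\int[P]_w _)%E = 1%E) ?ln1 // -integral_one.
  by apply: eq_integral => w _; rewrite mul0r expR0.
- move=> k s s0.
  have GL j : ln (G (j%:R * ln 2)) = L (lambda * (2 ^+ j - 1)).
    by rewrite /G /L expRM_natl lnK // posrE.
  (* Only the relation GL between G and L matters from here on. *)
  clear -key GL s0; clearbody G L p0.
  have := key (k%:R * ln 2) (k.+2%:R * ln 2) s s0.
  have -> : (k%:R * ln 2 + k.+2%:R * ln 2) / 2 = k.+1%:R * ln 2 :> R.
    by rewrite -[k.+2]addn2 -[k.+1]addn1 !natrD; field.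
  by rewrite (GL k) (GL k.+1) (GL k.+2).
Qed.

End subordinated_poisson.

(** * Compositions of inverse stable subordinators *)

Section good_versions.
Context d (T : measurableType d) (R : realType) (P : probability T R).
Variables (n : nat) (E : 'I_n -> R -> {RV P >-> R}) (N : R -> {RV P >-> nat}).
Variable M : set T.
Hypotheses (mM : measurable M) (M0 : P M = 0%E).

Definition version (o : option 'I_n) : R -> T -> R :=
  vanish_on M (if o is Some i then fun t => E i t else fun t w => (N t w)%:R).

Let raw (o : option 'I_n) : R -> T -> R :=
  if o is Some i then fun t => E i t else fun t w => (N t w)%:R.

Let mraw o t : measurable_fun setT (raw o t).
Proof.
case: o => [i|] /=; first exact: measurable_funPT.
exact: (measurable_fun_countable_subst (F := fun j => cst (j%:R : R))
  (measurable_funPT (N t))).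
Qed.

(** Off the null set the events of the two versions coincide, so all
    probabilities in the product rule agree. *)
Lemma version_independent : independent_processes E N ->
  mutual_independence P (fun o => marginal_events (version o)).
Proof.
move=> ind J A hA.
have /choice [tB htB] : forall o, exists tB : R * set R, o \in J ->
    [/\ 0 <= tB.1, measurable tB.2 & A o = version o tB.1 @^-1` tB.2].
  move=> o; have [oJ|oJ] := boolP (o \in J); last by exists (0, set0).
  by have [t t0 [B mB ->]] := hA o oJ; exists (t, B).
pose A' o := raw o (tB o).1 @^-1` (tB o).2.
have mA' o : o \in J -> measurable (A' o).
  move=> oJ; have [_ mB _] := htB o oJ.
  by rewrite -[X in measurable X]setTI; exact: mraw.
have mA o : o \in J -> measurable (A o).
  move=> oJ; have [_ mB ->] := htB o oJ.
  by rewrite -[X in measurable X]setTI; exact: measurable_vanish_on (mraw _ _) _ _ mB.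
have AA' o w : o \in J -> ~ M w -> A o w <-> A' o w.
  move=> oJ Mw; have [_ _ ->] := htB o oJ.
  by rewrite /A' /= /version vanish_onE.
transitivity (P (\bigcap_(o in [set o | o \in J]) A' o)).
  apply: (eq_probability_off_null mM M0).
  - by apply: fin_bigcap_measurable => //; exact: finite_finset.
  - by apply: fin_bigcap_measurable => //; exact: finite_finset.
  - by move=> w Mw; split => h o oJ; apply/(AA' _ _ oJ Mw); exact: h.
rewrite ind => [|o oJ].
  apply: eq_bigr => o oJ; apply: (eq_probability_off_null mM M0).
  - exact: mA'.
  - exact: mA.
  - by move=> w Mw; split => /(AA' _ _ oJ Mw).
have [t0 mB _] := htB o oJ.
rewrite /A' /raw; case: o oJ t0 mB => [i|] oJ t0 mB.
  exact: process_sigma_marginal.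
rewrite (_ : _ @^-1` _ = N (tB None).1 @^-1` [set k | (tB None).2 k%:R]) //.
exact: process_sigma_marginal.
Qed.

Lemma iterated_composition_version t w : ~ M w ->
  chain version (map Some (enum 'I_n)) t w =
  iterated_composition (fun i s => E i s : T -> R) t w.
Proof.
move=> Mw; rewrite /chain /iterated_composition.
elim: (enum 'I_n) => //= i l ->.
by rewrite /version vanish_onE.
Qed.

End good_versions.

(** One null set serves the finitely many processes at once. *)
Lemma inverse_paths_null_set d (T : measurableType d) (R : realType)
    (P : probability T R) (n : nat) (beta : 'I_n -> R)
    (E : 'I_n -> R -> {RV P >-> R}) (lambda : R) (N : R -> {RV P >-> nat}) :
  (forall i, inverse_stable_subordinator (beta i) (E i)) ->
  poisson_process lambda N ->
  exists (D : 'I_n -> R -> {RV P >-> R}) (M : set T),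
    [/\ forall i, stable_subordinator (beta i) (D i), measurable M, P M = 0%E,
      forall i w, ~ M w -> inverse_path (D i) (fun t => E i t : T -> R) w &
      forall w, ~ M w -> clock (fun t => (N t w)%:R : R)].
Proof.
move=> /choice [D hD] [_ _ Npath _].
have /choice [MD hMD] : forall i, exists M : set T, [/\ measurable M, P M = 0%E &
    forall w, ~ M w -> inverse_path (D i) (fun t => E i t : T -> R) w].
  move=> i; have [hDi hEi] := hD i.
  have [M [mM M0 hM]] := ae_inverse_path hDi hEi.
  exists M; split => // w Mw; apply: contrapT => h; apply: Mw; exact: hM.
have [M1 [mM1 M10 hM1]] := Npath.
pose A (o : option 'I_n) := if o is Some i then MD i else M1.
have [mA A0] : measurable (\bigcup_o A o) /\ P (\bigcup_o A o) = 0%E.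
  by apply: probability_bigcup0 => -[i|] //=; have [] := hMD i.
exists D, (\bigcup_o A o); split => //.
- by move=> i; case: (hD i).
- move=> i w Mw; have [_ _] := hMD i; apply.
  by move=> h; apply: Mw; exists (Some i).
- move=> w Mw; apply: nondecreasing_cadlag_clock => //.
  apply: contrapT => h; apply: Mw; exists None => //; exact: hM1.
Qed.

Theorem theorem3p2 (R : realType) (d : measure_display) (T : measurableType d)
    (P : probability T R) (n : nat) (hn : (1 <= n)%N)
    (beta : 'I_n -> R) (hbeta : forall i, 0 < beta i < 1)
    (lambda : R) (hlambda : 0 < lambda)
    (E : 'I_n -> R -> {RV P >-> R})
    (hE : forall i, inverse_stable_subordinator (beta i) (E i))
    (N : R -> {RV P >-> nat}) (hN : poisson_process lambda N)
    (hind : independent_processes E N) :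
  forall t : R, 0 < t ->
    law_not_infinitely_divisible P
      (fun w => (N (iterated_composition (fun i s => E i s : T -> R) t w) w)%:R).
Proof.
move=> t t0.
have [D [M [hD mM M0 hM NM]]] := inverse_paths_null_set hE hN.
pose X := version E N M.
have mE i s : measurable_fun setT (E i s : T -> R) by exact: measurable_funPT.
have cX o : clock_process (X o).
  case: o => [i|]; first exact: (clock_process_inverse (fun s _ => mE i s) mM (hM i)).
  apply: clock_process_vanish_on => // s _.
  exact: (measurable_fun_countable_subst (F := fun j => cst (j%:R : R))
    (measurable_funPT (N s))).
have indX := version_independent mM M0 hind.
pose S l := chain X (map Some l).
have cS l : clock_process (S l) by exact: clock_process_chain.
have hS l : uniq l -> tail_exponent P (S l) (\prod_(i <- l) beta i).
  elim: l => [|i l IH]; first by rewrite big_nil => _; exact: tail_exponent_id.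
  move=> /= /andP[il ul]; rewrite big_cons.
  apply: (tail_exponent_inverse_comp (hD i) (fun s _ => mE i s) mM M0 (hM i) (cS l)).
    exact: IH.
  move=> s v v0; rewrite tail_itvE.
  under eq_integral do rewrite tail_itvE.
  apply: (@chain_law _ _ _ P _ X cX indX (map Some l) (Some i) v `[s, +oo[%classic) => //.
  + by rewrite mem_map // => ? ? [].
  + by rewrite map_inj_uniq // => ? ? [].
  + exact: right_stable_itvcy.
pose l := enum 'I_n.
have ul : uniq l by exact: enum_uniq.
pose b := \prod_(i <- l) beta i.
have hb : 0 < b < 1.
  have b0 k : 0 < \prod_(i <- k) beta i by apply: prodr_gt0 => i _; have /andP[] := hbeta i.
  rewrite /b b0; have : (0 < size l)%N by rewrite /l size_enum_ord.
  case: (l) => // i k _; rewrite big_cons; have /andP[i0 i1] := hbeta i.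
  have : \prod_(j <- k) beta j <= 1.
    by apply: prodr_ile1 => j; have /andP[/ltW -> /ltW ->] := hbeta j.
  have := b0 k; move: (\prod_(j <- k) beta j) => r r0 r1.
  by apply: le_lt_trans (ler_piMr (ltW i0) r1) i1.
have S0 w : 0 <= S l t w by case: ((cS l).2 w) => + _ _; apply; exact: ltW.
pose Z w := X None (S l t w) w.
have mZ : measurable_fun setT Z.
  by apply: measurable_clock_subst => //; apply: (cS l).1; exact: ltW.
pose mixZ := isMeasurableFun.Build _ _ _ _ _ mZ.
pose rvZ : {RV P >-> R} := HB.pack Z mixZ.
have Znat w : exists k : nat, Z w = k%:R.
  have [Mw|Mw] := pselect (M w); first by exists 0%N; rewrite /Z /X /version vanish_on0.
  by exists (N (S l t w) w); rewrite /Z /X /version vanish_onE.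
exists rvZ; split.
  exists M; split => // w /=; apply: contra_notP => Mw.
  by rewrite /rvZ /= /Z /X /version vanish_onE // /S iterated_composition_version.
apply: (poisson_subordination_not_divisible (cS l) (hS l ul) hb t0 hlambda) => //.
move=> k; rewrite /=.
have XNE v w : ~ M w -> X None v w = (N v w)%:R.
  by move=> Mw; rewrite /X /version vanish_onE.
have Xnat v w : exists j : nat, X None v w = j%:R.
  have [Mw|Mw] := pselect (M w); first by exists 0%N; rewrite /X /version vanish_on0.
  by exists (N v w); rewrite XNE.
have Xk v w : `[k%:R, k.+1%:R[%classic (X None v w) <-> X None v w = k%:R.
  have [j ->] := Xnat v w; rewrite /= in_itv /= ler_nat ltr_nat ltnS.
  split => [|/eqP]; first by rewrite -eqn_leq => /eqP ->.
  by rewrite eqr_nat => /eqP ->; rewrite leqnn.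
transitivity (P [set w | `[k%:R, k.+1%:R[%classic (X None (S l t w) w)]).
  by congr (P _); apply/seteqP; split => w /= h; apply/Xk.
rewrite (@chain_law _ _ _ P _ X cX indX (map Some l) None t `[k%:R, k.+1%:R[%classic) //; last 4 first.
- by apply/mapP => -[].
- by rewrite map_inj_uniq // => ? ? [].
- exact: ltW.
- exact: right_stable_itvco.
apply: eq_integral => w _.
rewrite -(poisson_marginal k hlambda hN (S0 w)).
apply: (eq_probability_off_null mM M0).
- by apply: measurable_preimageT => //; apply: (cX None).1; exact: S0.
- exact: (measurable_preimage_nat k (measurable_funPT (N (S l t w)))).
- move=> w' Mw' /=; split => [/Xk|h]; last by apply/Xk; rewrite XNE // h.
  by rewrite XNE // => /eqP; rewrite eqr_nat => /eqP.
Qed.
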